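(* Let $\alpha=(\alpha_1,\dots,\alpha_r)$ and $\beta=(\beta_1,\dots,\beta_s)$ be tuples of parameters in $\mathbb{Q}\setminus\mathbb{Z}_{\leq 0}$ such that $F_{\alpha,\beta}$ is $N$-integral. Then there exists $C\in\mathbb{N}$ such that $$ C_{\alpha,\beta}=C\,\frac{\prod_{i=1}^r d(\alpha_i)}{\prod_{j=1}^s d(\beta_j)}\prod_{p\in\mathcal{P}_{\alpha,\beta}} p^{-\left\lfloor\frac{\lambda_p(\alpha,\beta)}{p-1}\right\rfloor}. $$ Furthermore, if $r=s$ and all elements of $\alpha$ and $\beta$ lie in $(0,1]$, then $C=1$.
   Context: For tuples $\alpha=(\alpha_1,\dots,\alpha_r)$, $\beta=(\beta_1,\dots,\beta_s)$ of parameters in $\mathbb{Q}\setminus\mathbb{Z}_{\leq 0}$, the generalized hypergeometric series is $F_{\alpha,\beta}(z)=\sum_{n\geq 0}\frac{(\alpha_1)_n\cdots(\alpha_r)_n}{(\beta_1)_n\cdots(\beta_s)_n}z^n$, where $(x)_n=x(x+1)\cdots(x+n-1)$ for $n\ge1$ and $(x)_0=1$. A power series $f(z)\in\mathbb{C}[[z]]$ is $N$-integral if there is $c\in\mathbb{Q}$ with $f(cz)\in\mathbb{Z}[[z]]$. If $F_{\alpha,\beta}$ is $N$-integral, the set of all $c\in\mathbb{Q}$ with $F_{\alpha,\beta}(cz)\in\mathbb{Z}[[z]]$ is $C_{\alpha,\beta}\mathbb{Z}$ for some $C_{\alpha,\beta}\in\mathbb{Q}\setminus\{0\}$. For a rational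 $a$, $d(a)$ denotes its exact denominator. $d_{\alpha,\beta}$ is the least common multiple of the exact denominators of the elements of $\alpha$ and $\beta$. For a prime $p$, $\lambda_p(\alpha,\beta)=\#\{1\le i\le r:\alpha_i\in\mathbb{Z}_p\}-\#\{1\le j\le s:\beta_j\in\mathbb{Z}_p\}$, where $\mathbb{Z}_p$ is the ring of $p$-adic integers. $\mathcal{P}_{\alpha,\beta}$ is the set of primes $p$ such that $p$ divides $d_{\alpha,\beta}$ or $p\le r-s+1$. *)

(* Defs.v *)
From HB Require Import structures.
From mathcomp Require Import all_boot all_order all_algebra.
Set Implicit Arguments.
Unset Strict Implicit.
Unset Printing Implicit Defensive.
Import Order.TTheory GRing.Theory Num.Theory.
Local Open Scope ring_scope.

Definition admissible (x : rat) : bool := ~~ ((x \is a Num.int) && (x <= 0)).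

Definition poch (x : rat) (n : nat) : rat := \prod_(k < n) (x + k%:R).

(* A formal power series is given by its sequence of coefficients. *)
Definition hypergeom (alpha beta : seq rat) (n : nat) : rat :=
  (\prod_(a <- alpha) poch a n) / (\prod_(b <- beta) poch b n).

Definition rescale (c : rat) (f : nat -> rat) (n : nat) : rat := f n * c ^+ n.

Definition integral_series (f : nat -> rat) : Prop :=
  forall n, f n \is a Num.int.

(* c = 0 must be excluded: f(0 z) is just the constant term of f. *)
Definition N_integral (f : nat -> rat) : Prop :=
  exists2 c : rat, c != 0 & integral_series (rescale c f).

(* The constant C_{alpha,beta}; since C Z = (- C) Z, it is normalised to be
   positive, which makes it unique. *)
Definition is_eisenstein_constant (alpha beta : seq rat) (C : rat) : Prop :=
  0 < C /\
  forall c : rat, integral_series (rescale c (hypergeom alpha beta)) <->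
                  exists k : int, c = C * k%:~R.

Definition den (a : rat) : nat := `|denq a|%N.

Definition den_lcm (alpha beta : seq rat) : nat :=
  \big[lcmn/1%N]_(a <- alpha ++ beta) den a.

(* For p prime and a != 0 this is the p-adic valuation of a. *)
Definition padic_val (p : nat) (a : rat) : int :=
  (logn p `|numq a|)%:Z - (logn p (den a))%:Z.

(* Membership in Z_p (p prime) of a rational; since padic_val p 0 = 0, the
   test is also correct at a = 0. *)
Definition in_Zp (p : nat) (a : rat) : bool := 0 <= padic_val p a.

Definition lambda (p : nat) (alpha beta : seq rat) : int :=
  (count (in_Zp p) alpha)%:Z - (count (in_Zp p) beta)%:Z.

Definition calP (alpha beta : seq rat) : pred nat := fun p =>
  prime p && ((p %| den_lcm alpha beta)%N
              || (p%:Z <= (size alpha)%:Z - (size beta)%:Z + 1)).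

Definition calP_bound (alpha beta : seq rat) : nat :=
  maxn (den_lcm alpha beta) (size alpha).+1.

Lemma den_lcm_gt0 (alpha beta : seq rat) : (0 < den_lcm alpha beta)%N.
Proof.
rewrite /den_lcm; elim/big_rec: _ => // a m _ m_gt0.
by rewrite lcmn_gt0 m_gt0 andbT absz_gt0 denq_neq0.
Qed.

(* Hence the product over calP is the bounded product in calP_factor. *)
Lemma calP_le_bound (alpha beta : seq rat) (p : nat) :
  calP alpha beta p -> (p <= calP_bound alpha beta)%N.
Proof.
rewrite /calP_bound leq_max => /andP[_ /orP[pd|pr]].
  by rewrite dvdn_leq // den_lcm_gt0.
apply/orP; right; rewrite -lez_nat (le_trans pr) //.
by rewrite -addn1 PoszD lerD2r lerBlDr lerDl.
Qed.

Definition calP_factor (alpha beta : seq rat) : rat :=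
  \prod_(0 <= p < (calP_bound alpha beta).+1 | calP alpha beta p)
     (p%:R : rat) ^ (- Num.floor ((lambda p alpha beta)%:~R / (p%:R - 1) : rat)).

(* Main.v *)
(* Existence of the generator C comes from Bezout: if a^n y and b^n y are integers
   with a and b coprime, so is y.  That C is a natural multiple of the displayed
   constant K is local: for x in Z_p the valuation of (x)_n at n = p^L is
   n / (p - 1) + O(1), while for x not in Z_p it is - n v_p(d(x)); letting L grow
   bounds v_p(C) from below.

   For the second assertion K itself must be admissible.  Integrality at large
   primes q gives, with n close to q R / P, Christol's inequality for the class of
   q modulo d; by Dirichlet's theorem every class coprime to d occurs.  Averaging
   these inequalities over the classes that agree with p^l away from p, and
   summing over l, gives exactly the lower bound on v_p needed.

   Dirichlet's theorem is proved without complex characters.  For real functions u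
   of sum 0 on the unit group G mod d let (T u)(g) be the sum of u(g m) / m.  Then
   T u has density 0 over the primes, and u has density - u(1) if T u = 0.  The
   kernel of T turns out to consist of multiples of real characters with L(1) = 0,
   hence is trivial; so T is onto, and all classes have equal density. *)

Require Import Defs.
From HB Require Import structures.
From mathcomp Require Import all_boot all_order all_algebra all_fingroup.
From mathcomp Require Import boolp reals Rstruct ring lra zify.
Set Implicit Arguments.
Unset Strict Implicit.
Unset Printing Implicit Defensive.
Import Order.TTheory GRing.Theory Num.Theory.
Local Open Scope ring_scope.

(* Arguments of type R would otherwise be parsed in R_scope. *)
Bind Scope ring_scope with Rdefinitions.RbaseSymbolsImpl.R.
Arguments Rpower.ln _%_ring_scope.

Local Notation R := Rdefinitions.R.
Local Notation ln := Rpower.ln.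

(** * Elementary estimates *)

(** The floor comes from integrality alone. With Q the quotient of the products of denominators, the
    growth of valuations gives only (p - 1)(v_p(C) - v_p(Q)) + lambda_p >= 0, and the first factor
    involves an integer. Outside the given set of primes every parameter is a p-adic integer and
    lambda_p = r - s < p - 1, so this inequality already yields v_p(C) >= 0 and no correction
    appears.

    The obstacle in the second assertion is a prime p dividing d: large primes only see residue
    classes coprime to d, so the class of p^l itself has no inequality. Averaging over the units
    that agree with p^l away from p is the substitute. Up to a term common to all parameters, the
    average counts the factors divisible by p^l when the parameter lies in Z_p, while for the others
    it telescopes in l to a total of n / (p - 1). The difference between the numbers of parameters
    of the second kind is lambda_p, as r = s.

    Dirichlet's theorem uses finite sums only: primes are weighted by Lambda(n)/n, for which
    Chebyshev's method gives log N with bounded error, so a bounded error is all that any later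
    estimate needs. *)

Lemma lnD (x y : R) : 0 < x -> 0 < y -> ln (x * y) = ln x + ln y.
Proof. by move=> x0 y0; apply: Rpower.ln_mult; apply/RltP. Qed.

Lemma ln_1 : ln 1 = 0.
Proof. exact: Rpower.ln_1. Qed.

Lemma ln_le_sub1 (x : R) : 0 < x -> ln x <= x - 1.
Proof.
move=> x0; have /RleP := Rpower.exp_ineq1_le (ln x).
rewrite Rpower.exp_ln ?RealsE; last exact/RltP.
by rewrite lerBrDl.
Qed.

Lemma ln_inv (x : R) : 0 < x -> ln x^-1 = - ln x.
Proof.
move=> x0; apply/eqP; rewrite -addr_eq0 -lnD ?invr_gt0 //.
by rewrite mulVf ?ln_1 // gt_eqF.
Qed.

Lemma ln_ge_1subV (x : R) : 0 < x -> 1 - x^-1 <= ln x.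
Proof.
move=> x0; have := @ln_le_sub1 x^-1; rewrite invr_gt0 => /(_ x0).
by rewrite ln_inv //; lra.
Qed.

Lemma ln_div (x y : R) : 0 < x -> 0 < y -> ln (x / y) = ln x - ln y.
Proof. by move=> x0 y0; rewrite lnD ?invr_gt0 // ln_inv. Qed.

Lemma ler_ln (x y : R) : 0 < x -> x <= y -> ln x <= ln y.
Proof.
move=> x0 xy; have y0 : 0 < y by apply: lt_le_trans xy.
rewrite -subr_ge0 -ln_div //; apply: le_trans (ln_ge_1subV _); last exact: divr_gt0.
by rewrite subr_ge0 invf_div ler_pdivrMr // mul1r.
Qed.

Lemma ln_nat_ge0 (n : nat) : (0 < n)%N -> 0 <= ln n%:R.
Proof.
by move=> n0; rewrite -ln_1; apply: ler_ln; rewrite ?ltr01 // ler1n.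
Qed.

Lemma ln_natM (m n : nat) :
  (0 < m)%N -> (0 < n)%N -> ln (m * n)%:R = ln m%:R + ln n%:R.
Proof. by move=> m0 n0; rewrite natrM lnD ?ltr0n. Qed.

Lemma ler_ln_nat (m n : nat) :
  (0 < m)%N -> (m <= n)%N -> ln m%:R <= ln n%:R.
Proof. by move=> m0 mn; apply: ler_ln; rewrite ?ltr0n // ler_nat. Qed.

Lemma lnSn_le (n : nat) : (0 < n)%N -> ln n.+1%:R <= ln n%:R + n%:R^-1.
Proof.
move=> n0; have n0' : 0 < n%:R :> R by rewrite ltr0n.
rewrite -lerBlDl -ln_div ?ltr0n //.
apply: le_trans (ln_le_sub1 _) _; first by rewrite divr_gt0 ?ltr0n.
by rewrite -natr1 mulrDl mulfV ?gt_eqF // mul1r addrC addKr.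
Qed.

(** The threshold 4 needs no numerical estimate: ln 4 = 2 ln 2 and ln 2 >= 1 - 1/2. From there on
    log t / t decreases. *)
Lemma ln_ge1 (n : nat) : (4 <= n)%N -> 1 <= ln n%:R.
Proof.
move=> n4; apply: le_trans (@ler_ln_nat 4 n _ n4) => //.
rewrite (@ln_natM 2 2) //.
have := @ln_ge_1subV 2; rewrite ltr0n => /(_ isT).
by lra.
Qed.

Lemma ln_div_anti (n : nat) : (4 <= n)%N ->
  ln n.+1%:R / n.+1%:R <= ln n%:R / n%:R.
Proof.
move=> n4; have n0 : 0 < n%:R :> R by rewrite ltr0n; apply: leq_trans n4.
rewrite ler_pdivrMr ?ltr0n // -mulrA [_^-1 * _]mulrC mulrA ler_pdivlMr //.
rewrite -[in leRHS]natr1 mulrDr mulr1.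
have := lnSn_le (leq_trans (isT : 0 < 4)%N n4).
have := ln_ge1 n4.
move=> h1 h2.
have : ln n.+1%:R * n%:R <= (ln n%:R + n%:R^-1) * n%:R by rewrite ler_pM2r.
rewrite mulrDl mulVf; last by rewrite gt_eqF.
lra.
Qed.

Lemma telescope_sum (c : nat -> R) (a b : nat) : (a <= b)%N ->
  \sum_(a <= i < b) (c i - c i.+1) = c a - c b.
Proof.
move=> ab; rewrite -[RHS]opprB -telescope_sumr // -sumrN.
by apply: eq_bigr => i _; rewrite opprB.
Qed.

(** Summation by parts: the differences of the decreasing weights are nonnegative and telescope, so
    the bound on the partial sums is paid for by the first weight only. *)
Lemma abel_bound (f c : nat -> R) (B : R) (a b : nat) : (a <= b)%N ->
  (forall m, (a <= m <= b)%N -> `|\sum_(a <= i < m) f i| <= B) ->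
  (forall n, (a <= n < b)%N -> c n.+1 <= c n) -> 0 <= c b ->
  `|\sum_(a <= i < b) f i * c i| <= B * c a.
Proof.
move=> ab hf hc cb; pose S m := \sum_(a <= i < m) f i.
have -> : \sum_(a <= i < b) f i * c i
   = S b * c b + \sum_(a <= i < b) S i.+1 * (c i - c i.+1).
  have key k : \sum_(a <= i < a + k) f i * c i
     = S (a + k)%N * c (a + k)%N + \sum_(a <= i < a + k) S i.+1 * (c i - c i.+1).
    elim: k => [|k IH]; first by rewrite addn0 /S !big_geq // mul0r addr0.
    rewrite addnS !big_nat_recr ?leq_addr //= IH /S big_nat_recr ?leq_addr //=.
    by ring.
  by rewrite -(subnKC ab) key.
apply: le_trans (ler_normD _ _) _.
have -> : B * c a = B * c b + \sum_(a <= i < b) B * (c i - c i.+1).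
  by rewrite -mulr_sumr telescope_sum //; ring.
apply: lerD.
  rewrite normrM (ger0_norm cb) ler_wpM2r //; apply: hf; by rewrite ab leqnn.
apply: le_trans (ler_norm_sum _ _ _) _.
rewrite big_nat_cond [leRHS]big_nat_cond; apply: ler_sum => i; rewrite andbT => /andP[ai ib].
have ci : 0 <= c i - c i.+1 by rewrite subr_ge0; apply: hc; rewrite ai ib.
rewrite normrM (ger0_norm ci) ler_wpM2r //; apply: hf.
by rewrite ib andbT (leq_trans ai).
Qed.

(** The limit is the supremum of the lower bounds s N - C / N; every s M + C / M is an upper bound
    for them, which gives existence and rate at once. *)
Lemma cauchy_rate (s : nat -> R) (C : R) :
  (forall M N, (0 < M)%N -> (M <= N)%N -> `|s N - s M| <= C / M%:R) ->
  exists l, forall N, (0 < N)%N -> `|l - s N| <= C / N%:R.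
Proof.
move=> hs.
have C0 : 0 <= C by have := hs 1%N 1%N isT isT; rewrite subrr normr0 divr1.
have Cn n : 0 <= C / n%:R :> R by rewrite divr_ge0.
pose E := fun x : R => exists2 N, (0 < N)%N & x = s N - C / N%:R.
have ubE M : (0 < M)%N -> classical_sets.ubound E (s M + C / M%:R).
  move=> M0 x [N N0 ->]; have [NM|MN] := leqP N M.
    by have := hs _ _ N0 NM; rewrite ler_norml => /andP[]; have := Cn M; lra.
  by have := hs _ _ M0 (ltnW MN); rewrite ler_norml => /andP[]; have := Cn N; lra.
have E0 : classical_sets.nonempty E by exists (s 1%N - C / 1%:R); exists 1%N.
exists (sup E) => N N0; rewrite ler_norml; apply/andP; split.
  have /(_ (s N - C / N%:R)) := @ub_le_sup _ E (ex_intro _ _ (ubE 1%N isT)).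
  by move=> /(_ (ex_intro2 _ _ N N0 erefl)); lra.
by have := ge_sup E0 (ubE N N0); lra.
Qed.

(** Both sides sum over the pairs with m j <= N, grouped by product or by m. In the induction, N %/
    m grows exactly when m divides N.+1. *)
Lemma hyperbola (V : zmodType) (F : nat -> nat -> V) (N : nat) :
  \sum_(1 <= k < N.+1) \sum_(1 <= m < N.+1 | (m %| k)%N) F m (k %/ m)%N
  = \sum_(1 <= m < N.+1) \sum_(1 <= j < (N %/ m).+1) F m j.
Proof.
rewrite (exchange_big_dep_nat predT) //=.
rewrite big_nat_cond [RHS]big_nat_cond; apply: eq_bigr => m; rewrite andbT => /andP[m0 _].
elim: N => [|N IH]; first by rewrite div0n !big_geq.
rewrite big_mkcond big_nat_recr //=.
rewrite -big_mkcond /= IH.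
have -> : (N.+1 %/ m = (m %| N.+1) + N %/ m)%N by apply: divnS.
case: (m %| N.+1)%N => /=; last by rewrite addr0 add0n.
by rewrite add1n [RHS]big_nat_recr.
Qed.

Lemma ln_fact_ge (N : nat) :
  N%:R * ln N%:R - N%:R <= \sum_(1 <= k < N.+1) ln k%:R.
Proof.
elim: N => [|N IH]; first by rewrite big_geq // !mul0r subr0.
rewrite big_nat_recr //=; case: N IH => [_|N IH].
  by rewrite big_geq // ln_1 mulr0; lra.
apply: le_trans (lerD IH (lexx _)).
have h := @lnSn_le N.+1 isT; have N0 : 0 < N.+1%:R :> R by rewrite ltr0n.
have : N.+1%:R * ln N.+2%:R <= N.+1%:R * (ln N.+1%:R + N.+1%:R^-1) by rewrite ler_pM2l.
rewrite mulrDr mulfV; last by rewrite gt_eqF.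
rewrite -[in X in X * _ <= _ -> _]natr1.
by set a := ln _; set b := ln _; rewrite -[N.+2%:R]natr1; lra.
Qed.

Lemma ln_fact_le (N : nat) : \sum_(1 <= k < N.+1) ln k%:R <= N%:R * ln N%:R.
Proof.
apply: le_trans (_ : \sum_(1 <= k < N.+1) ln N%:R <= _).
  rewrite big_nat_cond [leRHS]big_nat_cond; apply: ler_sum => i; rewrite andbT.
  by move=> /andP[i0 iN]; apply: ler_ln_nat.
by rewrite sumr_const_nat subSS subn0 mulr_natl.
Qed.

(** * The von Mangoldt and Moebius functions *)

Definition mangoldt (n : nat) : R := if primes n is [:: p] then ln p%:R else 0.

Lemma mangoldt_ge0 (n : nat) : 0 <= mangoldt n.
Proof.
rewrite /mangoldt; case E: (primes n) => [|p [|q s]] //; apply: ln_nat_ge0.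
have : p \in primes n by rewrite E inE.
by rewrite mem_primes => /andP[/prime_gt0].
Qed.

Lemma mangoldt_le_ln (n : nat) : (0 < n)%N -> mangoldt n <= ln n%:R.
Proof.
move=> n0; rewrite /mangoldt; case E: (primes n) => [|p [|q s]]; rewrite ?ln_nat_ge0 //.
have : p \in primes n by rewrite E inE.
rewrite mem_primes => /and3P[/prime_gt0 p0 _ pn].
by apply: ler_ln_nat => //; apply: dvdn_leq.
Qed.

Lemma mangoldt_pow (p k : nat) : prime p -> mangoldt (p ^ k.+1) = ln p%:R.
Proof. by move=> pp; rewrite /mangoldt primesX // primes_prime. Qed.

Lemma mangoldt_neq0 (n : nat) : mangoldt n != 0 -> exists p k, prime p /\ n = (p ^ k.+1)%N.
Proof.
rewrite /mangoldt; case E: (primes n) => [|p [|q s]]; rewrite ?eqxx // => _.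
have : p \in primes n by rewrite E inE.
rewrite mem_primes => /and3P[pp n0 pn]; exists p, (logn p n).-1; split=> //.
rewrite prednK; last by rewrite logn_gt0 mem_primes pp n0.
have := prod_prime_decomp n0; rewrite prime_decompE E /= big_seq1 /=.
by move=> <-.
Qed.

(** Strip one prime p from n = p n'. The only prime power dividing n but not n' is p to the exponent
    logn p n' + 1, and it contributes ln p. *)
Lemma sum_mangoldt (n N : nat) : (0 < n)%N -> (n <= N)%N ->
  \sum_(1 <= m < N.+1 | (m %| n)%N) mangoldt m = ln n%:R.
Proof.
elim/ltn_ind: n => n IH n0 nN.
have [n1|n1] := leqP n 1.
  have -> : n = 1%N by apply/eqP; rewrite eqn_leq n1 n0.
  rewrite ln_1 big1 // => m; rewrite dvdn1 => /eqP ->.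
  by rewrite /mangoldt.
pose p := pdiv n; have pp : prime p := pdiv_prime n1.
have p0 := prime_gt0 pp.
pose n' := (n %/ p)%N.
have nE : n = (p * n')%N by rewrite mulnC divnK // pdiv_dvd.
have n'0 : (0 < n')%N by move: n0; rewrite nE muln_gt0 => /andP[].
have n'n : (n' < n)%N by rewrite nE ltn_Pmull // prime_gt1.
rewrite (bigID (fun m => (m %| n')%N)) /=.
have -> : \sum_(1 <= i < N.+1 | (i %| n)%N && (i %| n')%N) mangoldt i = ln n'%:R.
  rewrite -(IH n') ?(leq_trans (ltnW n'n)) //; apply: eq_bigl => i.
  by rewrite andb_idl // => h; rewrite nE dvdn_mull.
rewrite nE ln_natM // ?prime_gt0 // addrC; congr (_ + _).
pose m0 := (p ^ (logn p n').+1)%N.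
have m0N : (m0 <= N)%N.
  apply: leq_trans nN; apply: dvdn_leq => //.
  by rewrite nE /m0 expnS dvdn_pmul2l // ?prime_gt0 // pfactor_dvdnn.
rewrite big_mkcond (bigD1_seq m0) ?iota_uniq //=; last first.
  by rewrite mem_index_iota ltnS m0N expn_gt0 prime_gt0.
have -> : (m0 %| p * n')%N by rewrite /m0 expnS dvdn_pmul2l // ?prime_gt0 // pfactor_dvdnn.
have -> : (m0 %| n')%N = false.
  by rewrite /m0 pfactor_dvdn // ltnn.
rewrite /= mangoldt_pow // big1 ?addr0 // => m mm0; case: ifP => // /andP[h1 h2].
apply/eqP; apply: contraNT mm0 => /mangoldt_neq0 [q [k [qp mE]]]; apply/eqP.
have [qE|qNp] := eqVneq q p; last first.
  have cop : coprime m p by rewrite mE coprime_pexpl // prime_coprime // dvdn_prime2.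
  by move: h1 h2; rewrite Gauss_dvdr // => ->.
move: h1 h2; rewrite mE qE /m0 !pfactor_dvdn // ?muln_gt0 ?p0 //.
rewrite lognM // ?prime_gt0 // logn_prime // eqxx add1n -ltnNge => h1 h2.
by congr (p ^ _)%N; apply/eqP; rewrite eqn_leq h1 h2.
Qed.

Lemma sum_multiples (V : nmodType) (F : nat -> V) (p N : nat) : (0 < p)%N ->
  \sum_(1 <= k < N.+1 | (p %| k)%N) F k = \sum_(1 <= j < (N %/ p).+1) F (p * j)%N.
Proof.
move=> p0; elim: N => [|N IH]; first by rewrite div0n !big_geq.
rewrite big_mkcond big_nat_recr //= -big_mkcond /= IH.
have -> : (N.+1 %/ p = (p %| N.+1) + N %/ p)%N by apply: divnS.
case E: (p %| N.+1)%N => /=; last by rewrite addr0 add0n.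
rewrite add1n [RHS]big_nat_recr //=; congr (_ + F _).
have := divnS N p0; rewrite E add1n => <-; by rewrite mulnC divnK.
Qed.

Definition moebius (n : nat) : R :=
  if (0 < n)%N && all (fun p => logn p n == 1%N) (primes n)
  then (-1) ^+ size (primes n) else 0.

Lemma moebius_norm (n : nat) : `|moebius n| <= 1.
Proof.
by rewrite /moebius; case: ifP => _; rewrite ?normr0 // normrX normrN1 expr1n.
Qed.

Lemma moebius1 : moebius 1 = 1.
Proof. by rewrite /moebius /= expr0. Qed.

Lemma moebius_sq (p n : nat) : prime p -> (p ^ 2 %| n)%N -> moebius n = 0.
Proof.
move=> pp d2; rewrite /moebius; case: ifP => // /andP[n0 /allP h].
have pn : p \in primes n.
  by rewrite mem_primes pp n0 (dvdn_trans _ d2) // expnS dvdn_mulr.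
by have := h _ pn; move: d2; rewrite pfactor_dvdn // => + /eqP E; rewrite E.
Qed.

Lemma moebius_mulp (p k : nat) : prime p -> ~~ (p %| k)%N -> moebius (p * k) = - moebius k.
Proof.
move=> pp pk; have k0 : (0 < k)%N by case: k pk => //; rewrite dvdn0.
have pe : perm_eq (primes (p * k)) (p :: primes k).
  apply: uniq_perm; rewrite ?primes_uniq //=.
    by rewrite primes_uniq andbT mem_primes (negbTE pk) !andbF.
  by move=> q; rewrite primesM // ?prime_gt0 // primes_prime // !inE.
rewrite /moebius muln_gt0 prime_gt0 // k0 (perm_all _ pe) (perm_size pe) /=.
rewrite lognM // ?prime_gt0 // logn_prime // eqxx.
have /eqP -> : logn p k == 0%N by rewrite -leqn0 leqNgt logn_gt0 mem_primes (negbTE pk) !andbF.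
rewrite addn0 /=.
have -> : all (fun q => logn q (p * k) == 1%N) (primes k)
        = all (fun q => logn q k == 1%N) (primes k).
  apply: eq_in_all => q; rewrite mem_primes => /and3P[qp _ qk].
  rewrite lognM // ?prime_gt0 // logn_prime //; have [E|//] := eqVneq q p.
  by rewrite -E qk in pk.
by case: ifP => _; rewrite ?oppr0 // exprS mulN1r.
Qed.

(** A divisor contributing to the sum is either prime to p, hence a divisor k of n, or p times such
    a k, with the opposite sign; divisors with p^2 contribute 0. *)
Lemma moebius_sum_rec (g : nat -> R) (p v n N : nat) : prime p -> ~~ (p %| n)%N ->
  (p ^ v.+1 * n <= N)%N ->
  \sum_(1 <= k < N.+1 | (k %| p ^ v.+1 * n)%N) moebius k * g k
  = \sum_(1 <= k < N.+1 | (k %| n)%N) moebius k * (g k - g (p * k)%N).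
Proof.
move=> pp pn leN; have p0 := prime_gt0 pp.
have n0 : (0 < n)%N by case: n pn {leN} => //; rewrite dvdn0.
have ndv k : (k %| n)%N -> ~~ (p %| k)%N.
  by move=> kn; apply: contra pn => pk; apply: dvdn_trans kn.
have nNp : (n <= N %/ p)%N.
  rewrite leq_divRL //; apply: leq_trans leN; rewrite mulnC leq_mul2r.
  by rewrite expnS leq_pmulr ?orbT // expn_gt0 p0.
have -> : \sum_(1 <= k < N.+1 | (k %| n)%N) moebius k * (g k - g (p * k)%N)
  = \sum_(1 <= k < N.+1 | (k %| n)%N) moebius k * g k
    - \sum_(1 <= k < N.+1 | (k %| n)%N) moebius k * g (p * k)%N.
  by rewrite -sumrB; apply: eq_bigr => k _; rewrite mulrBr.
rewrite (bigID (fun k => (p %| k)%N)) /= addrC; congr (_ + _).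
  apply: eq_bigl => k; apply/andP/idP => [[h1 h2]|h].
    by move: h1; rewrite Gauss_dvdr // coprimeXr // coprime_sym prime_coprime.
  by rewrite dvdn_mull // ndv.
rewrite (eq_bigl (fun k => (p %| k)%N && (k %| p ^ v.+1 * n)%N)); last by move=> k; rewrite andbC.
rewrite big_mkcondr sum_multiples //= -sumrN.
have -> : \sum_(1 <= k < N.+1 | (k %| n)%N) (- (moebius k * g (p * k)%N))
   = \sum_(1 <= k < (N %/ p).+1 | (k %| n)%N) (- (moebius k * g (p * k)%N)).
  rewrite (@big_nat_widen _ _ _ 1 (N %/ p).+1 N.+1); last by rewrite ltnS leq_div.
  apply: eq_bigl => k; rewrite andb_idr // => kn.
  by rewrite ltnS (leq_trans _ nNp) // dvdn_leq.
rewrite [RHS]big_mkcond /=; apply: eq_bigr => j _.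
rewrite expnS -mulnA dvdn_pmul2l //.
have [pj|pj] := boolP (p %| j)%N.
  rewrite [RHS]ifN; last by apply/negP => /ndv; rewrite pj.
  by rewrite (@moebius_sq p) ?mul0r ?if_same // expnS expn1 dvdn_pmul2l.
rewrite Gauss_dvdr; last by rewrite coprimeXr // coprime_sym prime_coprime.
by case: ifP => // _; rewrite moebius_mulp // mulNr.
Qed.

Lemma moebius_sum1 (g : nat -> R) (N : nat) : (0 < N)%N ->
  \sum_(1 <= k < N.+1 | (k %| 1)%N) moebius k * g k = g 1%N.
Proof.
move=> N0; rewrite big_mkcond (bigD1_seq 1%N) ?iota_uniq //=; last by rewrite mem_index_iota.
rewrite moebius1 mul1r big1 ?addr0 // => k; rewrite dvdn1.
by case: (k == 1%N).
Qed.

Lemma prime_factorization_step (n : nat) : (1 < n)%N ->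
  exists p v m, [/\ prime p, ~~ (p %| m)%N, n = (p ^ v.+1 * m)%N & (0 < m < n)%N].
Proof.
move=> n1; have n0 := ltnW n1.
have pp := pdiv_prime n1; have [m cop nE] := pfactor_coprime pp n0.
have lg : (0 < logn (pdiv n) n)%N by rewrite logn_gt0 mem_primes pp n0 pdiv_dvd.
exists (pdiv n), (logn (pdiv n) n).-1, m; rewrite prednK //; split=> //.
- by rewrite -prime_coprime.
- by rewrite mulnC.
have m0 : (0 < m)%N by move: n0; rewrite {1}nE muln_gt0 => /andP[].
rewrite m0 /= {1}nE ltn_Pmulr //.
by rewrite -{1}(exp1n (logn (pdiv n) n)) ltn_exp2r // prime_gt1.
Qed.

Lemma moebius_sum (n N : nat) : (0 < n)%N -> (n <= N)%N ->
  \sum_(1 <= k < N.+1 | (k %| n)%N) moebius k = (n == 1%N)%:R.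
Proof.
move=> n0 nN.
have -> : \sum_(1 <= k < N.+1 | (k %| n)%N) moebius k
   = \sum_(1 <= k < N.+1 | (k %| n)%N) moebius k * 1 by apply: eq_bigr => *; rewrite mulr1.
have [n1|n1] := leqP n 1.
  have -> : n = 1%N by apply/eqP; rewrite eqn_leq n1 n0.
  by rewrite moebius_sum1 ?eqxx // (leq_trans n0).
rewrite gtn_eqF //.
have [p [v [m [pp pm nE _]]]] := prime_factorization_step n1.
rewrite nE (@moebius_sum_rec (fun=> 1)) //; last by rewrite -nE.
by rewrite big1 // => *; rewrite subrr mulr0.
Qed.

Lemma moebius_sum_ln (n N : nat) : (0 < n)%N -> (n <= N)%N ->
  \sum_(1 <= k < N.+1 | (k %| n)%N) moebius k * ln k%:R = - mangoldt n.
Proof.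
move=> n0 nN; have [n1|n1] := leqP n 1.
  have -> : n = 1%N by apply/eqP; rewrite eqn_leq n1 n0.
  by rewrite moebius_sum1 ?(leq_trans n0) // ln_1 /mangoldt /= oppr0.
have [p [v [m [pp pm nE /andP[m0 mn]]]]] := prime_factorization_step n1.
rewrite nE (@moebius_sum_rec (fun k => ln k%:R)) //; last by rewrite -nE.
have -> : \sum_(1 <= k < N.+1 | (k %| m)%N) moebius k * (ln k%:R - ln (p * k)%:R)
    = - ln p%:R * \sum_(1 <= k < N.+1 | (k %| m)%N) moebius k.
  rewrite mulr_sumr big_nat_cond [RHS]big_nat_cond; apply: eq_bigr => k.
  by move=> /andP[/andP[k0 _] _]; rewrite ln_natM // ?prime_gt0 //; ring.
rewrite moebius_sum //; last by rewrite ltnW // (leq_trans mn).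
case: eqP => [->|/eqP m1]; first by rewrite muln1 mangoldt_pow // mulr1.
rewrite mulr0; apply/esym/eqP; rewrite oppr_eq0; apply: contraT => /mangoldt_neq0[q [k [qp E]]].
have h (r : nat) : prime r -> (r %| p ^ v.+1 * m)%N -> r = q.
  by move=> rp; rewrite E Euclid_dvdX // => /andP[+ _]; rewrite dvdn_prime2 // => /eqP.
have pq : p = q by apply: h => //; rewrite expnS -mulnA dvdn_mulr.
have m1' : (1 < m)%N by rewrite ltn_neqAle eq_sym m1.
have : pdiv m = q by apply: h (pdiv_prime m1') _; rewrite dvdn_mull // pdiv_dvd.
by move=> h'; move: pm; rewrite pq -h' pdiv_dvd.
Qed.

Definition psi (N : nat) : R := \sum_(1 <= n < N.+1) mangoldt n.

Lemma ln_fact_mangoldt (N : nat) :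
  \sum_(1 <= k < N.+1) ln k%:R = \sum_(1 <= n < N.+1) mangoldt n * (N %/ n)%:R.
Proof.
have := hyperbola (fun m _ => mangoldt m) N.
have -> : \sum_(1 <= k < N.+1) \sum_(1 <= m < N.+1 | (m %| k)%N) mangoldt m
   = \sum_(1 <= k < N.+1) ln k%:R.
  by apply: eq_big_nat => k /andP[k0 kN]; rewrite sum_mangoldt.
move=> ->; apply: eq_bigr => m _.
by rewrite sumr_const_nat subSS subn0 mulr_natr.
Qed.

(** Chebyshev: the difference is bounded by the logarithm of the central binomial coefficient,
    because N/n rounded down never exceeds half of 2N/n rounded down, and for N < n <= 2N the two
    values are 0 and at least 1. *)
Lemma psi_double (N : nat) : (0 < N)%N -> psi (2 * N) - psi N <= 4 * N%:R.
Proof.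
move=> N0.
pose T M : R := \sum_(1 <= k < M.+1) ln k%:R.
have NN : (N <= 2 * N)%N by rewrite leq_pmull.
have up : T (2 * N)%N - 2 * T N <= 4 * N%:R.
  have h1 := ln_fact_le (2 * N); have h2 := ln_fact_ge N.
  have h3 : ln 2%:R <= 1 :> R by apply: le_trans (ln_le_sub1 _) _; lra.
  have N0' : 0 <= N%:R :> R by [].
  have h4 : N%:R * ln 2%:R <= N%:R :> R by rewrite ler_piMr.
  move: h1 h2; rewrite -/(T _) -/(T _) ln_natM // natrM mulrDr; lra.
apply: le_trans up.
have -> : T N = \sum_(1 <= n < (2 * N).+1) mangoldt n * (N %/ n)%:R.
  rewrite /T ln_fact_mangoldt [RHS](@big_cat_nat _ _ _ N.+1) //=.
  rewrite [X in _ = _ + X]big_nat_cond [X in _ = _ + X]big1 ?addr0 // => i /andP[/andP[h _] _].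
  by rewrite divn_small // mulr0.
rewrite /T ln_fact_mangoldt mulr_sumr -sumrB /psi (@big_cat_nat _ _ _ N.+1) //= addrAC subrr add0r.
rewrite [leRHS](@big_cat_nat _ _ _ N.+1) //= -[leLHS]add0r; apply: lerD.
  apply: sumr_ge0 => n _; rewrite mulrCA -mulrBr mulr_ge0 ?mangoldt_ge0 //.
  by case: n => [|n]; rewrite subr_ge0 -natrM ler_nat ?divn0 // leq_divRL // -mulnA leq_mul2l leq_divM.
rewrite big_nat_cond [leRHS]big_nat_cond; apply: ler_sum => n /andP[/andP[h1 h2] _].
rewrite (divn_small h1) mulr0 mulr0 subr0 ler_peMr ?mangoldt_ge0 // ler1n.
by rewrite divn_gt0 // (leq_trans _ h1).
Qed.

Lemma psi_le (N : nat) : psi N <= 10 * N%:R.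
Proof.
elim/ltn_ind: N => N IH; have [N1|N1] := leqP N 1.
  rewrite /psi; case: N N1 {IH} => [|[|//]] _; first by rewrite big_geq // mulr0.
  by rewrite big_nat1 /mangoldt /=; lra.
(* Halving: doubling M costs 4 M, and for odd N the last term is at most ln (2 M + 1) <= 2 M, so 10
   M + 6 M stays below 20 M. *)
pose M := N./2; have M0 : (0 < M)%N by rewrite half_gt0.
have MN : (M < N)%N by rewrite /M ltn_half_double; lia.
have h1 := IH _ MN; have h2 := psi_double M0.
have NE := odd_double_half N; rewrite -/M -mul2n in NE.
clearbody M; case: (odd N) NE => /=; rewrite ?add1n ?add0n => NE; rewrite -NE; last first.
  by rewrite natrM; have : 0 <= M%:R :> R by []; lra.
rewrite /psi big_nat_recr //= -/(psi _) -[(2 * M).+1%:R]natr1 natrM.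
have h3 := @mangoldt_le_ln (2 * M).+1 isT.
have h4 : ln (2 * M).+1%:R <= 2 * M%:R :> R.
  apply: le_trans (ln_le_sub1 _) _; first by rewrite ltr0n.
  by rewrite -[(2 * M).+1%:R]natr1 addrK natrM.
by have : 0 <= M%:R :> R by []; lra.
Qed.

(** Removing the integer parts in ln N! = sum of Lambda(n) (N %/ n) costs at most psi N <= 10 N;
    then divide by N and use the bounds on N!. *)
Lemma mertens (N : nat) : (0 < N)%N ->
  `|\sum_(1 <= n < N.+1) mangoldt n / n%:R - ln N%:R| <= 10.
Proof.
move=> N0; have N0' : 0 < N%:R :> R by rewrite ltr0n.
set S := \sum_(_ <= _ < _) _.
have h1 := ln_fact_le N; have h2 := ln_fact_ge N; have h3 := psi_le N.
have E : N%:R * S = \sum_(1 <= n < N.+1) mangoldt n * (N%:R / n%:R).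
  by rewrite mulr_sumr; apply: eq_bigr => n _; ring.
have lo : \sum_(1 <= k < N.+1) ln k%:R <= N%:R * S.
  rewrite ln_fact_mangoldt E big_nat_cond [leRHS]big_nat_cond; apply: ler_sum => n.
  move=> /andP[/andP[n0 _] _]; rewrite ler_wpM2l ?mangoldt_ge0 //.
  by rewrite ler_pdivlMr ?ltr0n // -natrM ler_nat leq_divM.
have hi : N%:R * S <= \sum_(1 <= k < N.+1) ln k%:R + psi N.
  rewrite ln_fact_mangoldt E -big_split /= big_nat_cond [leRHS]big_nat_cond; apply: ler_sum => n.
  move=> /andP[/andP[n0 _] _]; rewrite -[X in _ + X]mulr1 -mulrDr ler_wpM2l ?mangoldt_ge0 //.
  rewrite ler_pdivrMr ?ltr0n // natr1 -natrM ler_nat ltnW //.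
  by rewrite ltn_ceil.
rewrite ler_norml; apply/andP; split; rewrite -(ler_pM2l N0'); lra.
Qed.

(** * Sums over prime powers twisted by an oscillating function *)

Lemma eq_imp_le (x y : R) : x = y -> x <= y.
Proof. by move->. Qed.

Lemma ler_sum_nat (F G : nat -> R) (a b : nat) :
  (forall i, (a <= i < b)%N -> F i <= G i) ->
  \sum_(a <= i < b) F i <= \sum_(a <= i < b) G i.
Proof.
move=> h; rewrite big_nat_cond [leRHS]big_nat_cond; apply: ler_sum => i.
by rewrite andbT; apply: h.
Qed.

Lemma norm_sum_nat (F G : nat -> R) (a b : nat) :
  (forall i, (a <= i < b)%N -> `|F i| <= G i) ->
  `|\sum_(a <= i < b) F i| <= \sum_(a <= i < b) G i.
Proof. by move=> h; apply: le_trans (ler_norm_sum _ _ _) _; apply: ler_sum_nat. Qed.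

Lemma sum_nat_mono (F : nat -> R) (P : pred nat) (a b c : nat) : (b <= c)%N ->
  (forall i, 0 <= F i) ->
  \sum_(a <= i < b | P i) F i <= \sum_(a <= i < c | P i) F i.
Proof.
move=> bc F0; rewrite (big_nat_widen _ _ _ _ _ bc) big_mkcond [leRHS]big_mkcond /=.
apply: ler_sum => i _; case: (P i); case: (i < b)%N => //=.
Qed.

Lemma geometric_tail (p k M : nat) : (2 <= p)%N ->
  \sum_(k <= i < M) (p%:R ^+ i.+1)^-1 <= 2 / p%:R ^+ k.+1 :> R.
Proof.
move=> p2; have p0 : 0 < p%:R :> R by rewrite ltr0n; apply: leq_trans p2.
have p2' : 2 <= p%:R :> R by rewrite (ler_nat _ 2).
have [Mk|kM] := leqP M k.
  by rewrite big_geq // divr_ge0 // exprn_ge0 // ltW.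
pose c i : R := 2 / p%:R ^+ i.+1.
apply: le_trans (_ : \sum_(k <= i < M) (c i - c i.+1) <= _).
  apply: ler_sum_nat => i _; rewrite /c [p%:R ^+ i.+2]exprS.
  set x := p%:R ^+ _; have x0 : 0 < x by rewrite exprn_gt0.
  rewrite invfM mulrA -subr_ge0.
  have -> : 2 / x - 2 / p%:R / x - x^-1 = (1 - 2 / p%:R) / x by ring.
  by rewrite divr_ge0 ?(ltW x0) // subr_ge0 ler_pdivrMr // mul1r.
rewrite telescope_sum ?(ltnW kM) // /c gerBl.
by rewrite divr_ge0 // exprn_ge0 // ltW.
Qed.

(** Each prime power is charged to its prime, and a geometric series of ratio at most 1/2 is at most
    twice its first term. Used with [k0] = 0 for the primes dividing a modulus and with [k0] = 1 for
    proper prime powers. *)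
Lemma mangoldt_sum_le (P Q : pred nat) (k0 N : nat) :
  (forall p k, prime p -> P (p ^ k.+1)%N -> Q p && (k0 <= k)%N) ->
  \sum_(1 <= n < N.+1 | P n) mangoldt n / n%:R
   <= \sum_(2 <= p < N.+1 | Q p) 2 * ln p%:R / p%:R ^+ k0.+1.
Proof.
move=> hPQ; pose g p k : R := ln p%:R / p%:R ^+ k.+1.
have g0 p k : (2 <= p)%N -> 0 <= g p k.
  by move=> p2; rewrite divr_ge0 ?exprn_ge0 // ln_nat_ge0 // (leq_trans _ p2).
pose G n : R := \sum_(2 <= p < N.+1 | Q p) \sum_(k0 <= k < N.+1)
  (if n == (p ^ k.+1)%N then g p k else 0).
have G0 n : 0 <= G n.
  rewrite /G big_nat_cond; apply: sumr_ge0 => p /andP[/andP[p2 _] _].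
  by apply: sumr_ge0 => k _; case: ifP => // _; apply: g0.
apply: le_trans (_ : \sum_(1 <= n < N.+1 | P n) G n <= _).
  rewrite big_nat_cond [leRHS]big_nat_cond; apply: ler_sum => n /andP[/andP[n0 nN] Pn].
  have [->|/mangoldt_neq0 [p [k [pp nE]]]] := eqVneq (mangoldt n) 0; first by rewrite mul0r.
  have /andP[Qp k0k] : Q p && (k0 <= k)%N by apply: hPQ => //; rewrite -nE.
  have p2 := prime_gt1 pp.
  have pn : (p <= n)%N by rewrite nE expnS leq_pmulr // expn_gt0 prime_gt0.
  have kn : (k < n)%N by rewrite nE; apply: ltn_trans (ltn_expl _ p2).
  rewrite {1}/G big_mkcond (bigD1_seq p) ?iota_uniq //=; last first.
    by rewrite mem_index_iota p2 (leq_ltn_trans pn).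
  rewrite Qp (bigD1_seq k) ?iota_uniq //=; last first.
    by rewrite mem_index_iota k0k (ltn_trans kn).
  rewrite -nE eqxx {1}nE mangoldt_pow // /g -natrX -nE -addrA lerDl addr_ge0 //.
    by apply: sumr_ge0 => i _; case: ifP => // _; apply: g0.
  rewrite big_nat_cond; apply: sumr_ge0 => i /andP[/andP[i2 _] _]; case: ifP => // _.
  by apply: sumr_ge0 => j _; case: ifP => // _; apply: g0.
apply: le_trans (_ : \sum_(1 <= n < N.+1) G n <= _).
  by rewrite [leLHS]big_mkcond; apply: ler_sum => n _; case: (P n).
rewrite /G exchange_big_nat /=.
rewrite big_nat_cond [leRHS]big_nat_cond; apply: ler_sum => p /andP[/andP[p2 _] _].
rewrite exchange_big_nat /=.
apply: le_trans (_ : \sum_(k0 <= k < N.+1) g p k <= _).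
  apply: ler_sum => k _; rewrite -big_mkcond /=.
  have [h|h] := boolP ((p ^ k.+1)%N \in index_iota 1 N.+1); last first.
    rewrite big_seq_cond big1 ?g0 // => n /andP[nin /eqP nE].
    by rewrite nE (negbTE h) in nin.
  rewrite big_mkcond (bigD1_seq _ h) ?iota_uniq //= eqxx big1 ?addr0 // => n.
  by move=> /negbTE ->.
rewrite /g -mulr_sumr mulrAC mulrC ler_wpM2r ?ln_nat_ge0 ?(leq_trans _ p2) //.
by apply: geometric_tail.
Qed.

(* The density over the primes, prime powers being harmless, with the error
   term O(1) in place of o(log N). *)
Definition dens (v : nat -> R) (c : R) : Prop :=
  exists C, forall N, (0 < N)%N ->
    `|\sum_(1 <= n < N.+1) mangoldt n / n%:R * v n - c * ln N%:R| <= C.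

Lemma dens_coprime (d : nat) : (0 < d)%N -> dens (fun n => (coprime d n)%:R) 1.
Proof.
move=> d0; exists (10 + \sum_(2 <= p < d.+1) 2) => N N0.
pose S : R := \sum_(1 <= n < N.+1) mangoldt n / n%:R.
have := mertens N0; rewrite -/S => h.
pose S1 : R := \sum_(1 <= n < N.+1) mangoldt n / n%:R * (coprime d n)%:R; rewrite -/S1.
have -> : S1 = S - \sum_(1 <= n < N.+1 | ~~ coprime d n) mangoldt n / n%:R.
  apply/eqP; rewrite eq_sym subr_eq; apply/eqP.
  rewrite [LHS](bigID (coprime d)) /=; congr (_ + _); rewrite [LHS]big_mkcond /S1.
  by apply: eq_bigr => n _; case: coprime; rewrite ?mulr1 ?mulr0.
pose S2 : R := \sum_(1 <= n < N.+1 | ~~ coprime d n) mangoldt n / n%:R; rewrite -/S2.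
have S20 : 0 <= S2 by apply: sumr_ge0 => n _; rewrite divr_ge0 ?mangoldt_ge0.
have S2le : S2 <= \sum_(2 <= p < d.+1) 2.
  apply: le_trans (@mangoldt_sum_le _ (fun p => p %| d)%N 0 N _) _.
    move=> p k pp; by rewrite coprime_sym coprime_pexpl // prime_coprime // negbK andbT.
  apply: le_trans (_ : \sum_(2 <= p < N.+1 | (p < d.+1)%N) 2 <= _).
    rewrite big_nat_cond big_mkcond [leRHS]big_nat_cond [leRHS]big_mkcond /=.
    apply: ler_sum => p _; case: ifP => [/andP[/andP[p2 pN] pd]|_]; last by case: ifP.
    rewrite p2 pN /= ltnS dvdn_leq // expr1 ler_pdivrMr ?ltr0n ?(leq_trans _ p2) //.
    rewrite ler_pM2l //; apply: le_trans (ln_le_sub1 _) _; first by rewrite ltr0n (leq_trans _ p2).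
    by rewrite gerBl.
  apply: le_trans (_ : \sum_(2 <= p < (N + d).+1 | (p < d.+1)%N) 2 <= _).
    by apply: sum_nat_mono => //; rewrite ltnS leq_addr.
  by rewrite [leRHS](@big_nat_widen _ _ _ 2 d.+1 (N + d).+1) ?ltnS ?leq_addl //=.
move: h; rewrite mul1r !ler_norml => /andP[h1 h2]; apply/andP; split; lra.
Qed.

Lemma mangoldt_nonprime_bound : exists C, forall N,
  \sum_(1 <= n < N.+1 | ~~ prime n) mangoldt n / n%:R <= C.
Proof.
exists 4 => N; apply: le_trans (@mangoldt_sum_le _ predT 1 N _) _.
  by move=> p [|k] // pp; rewrite expn1 pp.
case: N => [|N]; first by rewrite big_geq.
(* An antiderivative of ln t / t^2 is -(ln t + 1) / t; the constant 2 in place of 1 leaves room for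
   the passage to differences. The final bound 4 is F 1. *)
pose F n : R := 2 * ((ln n%:R + 2) / n%:R).
rewrite big_add1 /=.
apply: le_trans (_ : \sum_(1 <= p < N.+1) (F p - F p.+1) <= _).
  apply: ler_sum_nat => x /andP[x0 _].
  have x0' : 0 < x%:R :> R by rewrite ltr0n.
  have x1 : 1 <= x%:R :> R by rewrite ler1n.
  have l1 := lnSn_le x0; have l0 := ln_nat_ge0 x0.
  have xV : x%:R^-1 <= 1 :> R by rewrite invf_le1.
  have xxV : x%:R * x%:R^-1 = 1 :> R by rewrite divff // gt_eqF.
  have sx0 : 0 < x.+1%:R :> R by rewrite ltr0n.
  rewrite /F; set a := ln x%:R in l1 l0 *; set b := ln x.+1%:R in l1 *.
  have zE : x.+1%:R = x%:R + 1 :> R by rewrite natr1.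
  set y := x%:R in x0' x1 xxV l1 zE *; set z := x.+1%:R in sx0 zE *.
  clearbody y z.
  rewrite -subr_ge0.
  have -> : 2 * ((a + 2) / y) - 2 * ((b + 2) / z) - 2 * b / z ^+ 2
     = 2 * ((a + 2) * z ^+ 2 - (b + 2) * (y * z) - b * y) / (y * z ^+ 2).
    by field; rewrite !gt_eqF.
  rewrite divr_ge0 ?mulr_ge0 ?exprn_ge0 ?(ltW x0') ?(ltW sx0) //.
  have hb : b * y <= a * y + 1.
    have : 0 <= (a + y^-1 - b) * y by rewrite mulr_ge0 ?(ltW x0') // subr_ge0.
    by lra.
  have -> : (a + 2) * z ^+ 2 - (b + 2) * (y * z) - b * y
     = (a * y + 1 - b * y) * y + 2 * (a * y + 1 - b * y) + a + y by rewrite zE; ring.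
  by rewrite !addr_ge0 ?mulr_ge0 ?subr_ge0 // ltW.
rewrite telescope_sum // /F ln_1 add0r divr1.
have : 0 <= (ln N.+1%:R + 2) / N.+1%:R :> R by rewrite divr_ge0 // addr_ge0 // ln_nat_ge0.
by move: (_ / _) => t h; lra.
Qed.

Lemma inv_floor_le (N m : nat) : (0 < m <= N)%N -> (N %/ m)%:R^-1 <= 2 * m%:R / N%:R :> R.
Proof.
move=> /andP[m0 mN]; have q0 : (0 < N %/ m)%N by rewrite divn_gt0.
rewrite -[leLHS]mul1r ler_pdivrMr ?ltr0n // mulrAC ler_pdivlMr ?ltr0n ?(leq_trans m0) //.
rewrite mul1r -natrM -natrM ler_nat.
have := ltn_ceil N m0; nia.
Qed.

Lemma hyperbola_mul (c w : nat -> R) (N : nat) :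
  \sum_(1 <= k < N.+1) (w k / k%:R * \sum_(1 <= m < N.+1 | (m %| k)%N) c m)
  = \sum_(1 <= m < N.+1) (c m / m%:R * \sum_(1 <= j < (N %/ m).+1) w (m * j)%N / j%:R).
Proof.
have := hyperbola (fun m j => c m / m%:R * (w (m * j)%N / j%:R)) N.
under [RHS]eq_bigr => m _ do rewrite -mulr_sumr.
move=> <-; apply: eq_big_nat => k /andP[k0 _].
rewrite mulr_sumr; apply: eq_bigr => m mk.
rewrite -{1 2}(divnK mk) natrM invfM [(_ * m)%N]mulnC; ring.
Qed.

Section Twisted.
Variables (u : nat -> R) (B C : R).
Hypothesis uB : forall n a b, (0 < n)%N -> `|\sum_(a <= m < b) u (n * m)%N| <= B.

Lemma twisted_log_bound : exists C', forall N,
  `|\sum_(1 <= k < N.+1) u k / k%:R * ln k%:R| <= C'.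
Proof.
exists (\sum_(1 <= k < 4) `|u k / k%:R * ln k%:R| + B * (ln 4 / 4)) => N.
have B0 : 0 <= B by have := @uB 1 0 0 isT; rewrite big_geq // normr0.
have l4 : 0 <= ln 4 / 4 :> R by rewrite divr_ge0 // (@ln_nat_ge0 4).
have [N4|N4] := leqP 4 N.+1.
  rewrite (@big_cat_nat _ _ _ 4) //=; apply: le_trans (ler_normD _ _) _.
  apply: lerD; first exact: ler_norm_sum.
  have -> : \sum_(4 <= k < N.+1) u k / k%:R * ln k%:R = \sum_(4 <= k < N.+1) u k * (ln k%:R / k%:R).
    by apply: eq_bigr => k _; ring.
  apply: (abel_bound (c := fun k => ln k%:R / k%:R)) => //.
  - move=> m _; have := @uB 1 4 m isT.
    by under eq_bigr do rewrite mul1n.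
  - by move=> n /andP[n4 _]; apply: ln_div_anti.
  by rewrite divr_ge0 // ln_nat_ge0.
apply: le_trans (ler_norm_sum _ _ _) _.
apply: le_trans (@sum_nat_mono (fun k => `|u k / k%:R * ln k%:R|) predT 1 N.+1 4 (ltnW N4) _) _ => //.
by rewrite lerDl mulr_ge0.
Qed.

(* Convolve log = 1 * Lambda against u. *)
Lemma dens_transform (tu : nat -> R) :
  (forall n N, (0 < n)%N -> (0 < N)%N ->
     `|tu n - \sum_(1 <= m < N.+1) u (n * m)%N / m%:R| <= C / N%:R) ->
  dens tu 0.
Proof.
move=> htu; have [C' hC'] := twisted_log_bound.
have C0 : 0 <= C by have := htu 1%N 1%N isT isT; rewrite divr1; apply: le_trans.
exists (C' + 20 * C) => N N0; rewrite mul0r subr0.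
have N0' : 0 < N%:R :> R by rewrite ltr0n.
have := hyperbola_mul mangoldt u N.
rewrite (eq_big_nat _ _ (F2 := fun k => u k / k%:R * ln k%:R)); last first.
  by move=> k /andP[k0 kN]; rewrite sum_mangoldt.
move=> E; set S := \sum_(_ <= _ < _) _.
have -> : S = (\sum_(1 <= k < N.+1) u k / k%:R * ln k%:R)
   + \sum_(1 <= m < N.+1) mangoldt m / m%:R * (tu m - \sum_(1 <= j < (N %/ m).+1) u (m * j)%N / j%:R).
  by rewrite E -big_split /=; apply: eq_bigr => m _; rewrite -mulrDr addrC subrK.
apply: le_trans (ler_normD _ _) _; apply: lerD => //.
(* Cutting the m-th inner sum at N %/ m costs at most 2 C m / N, so the total error is 2 C psi N /
   N, bounded by Chebyshev. *)
apply: le_trans (_ : \sum_(1 <= m < N.+1) 2 * C / N%:R * mangoldt m <= _).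
  apply: norm_sum_nat => m /andP[m0 mN].
  rewrite normrM ger0_norm ?divr_ge0 ?mangoldt_ge0 //.
  have q0 : (0 < N %/ m)%N by rewrite divn_gt0.
  have m0' : 0 < m%:R :> R by rewrite ltr0n.
  have h := @inv_floor_le N m; rewrite m0 -ltnS mN in h.
  apply: le_trans (_ : mangoldt m / m%:R * (C * (2 * m%:R / N%:R)) <= _).
    rewrite ler_wpM2l ?divr_ge0 ?mangoldt_ge0 //; apply: le_trans (htu _ _ m0 q0) _.
    by rewrite ler_wpM2l // h.
  by apply: eq_imp_le; field; rewrite !gt_eqF.
rewrite -mulr_sumr -/(psi N); have := psi_le N.
rewrite -(ler_pM2l (_ : 0 < N%:R^-1)) ?invr_gt0 //.
rewrite [X in _ <= X -> _]mulrCA mulVf ?gt_eqF // mulr1 => h.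
have -> : 2 * C / N%:R * psi N = 2 * C * (N%:R^-1 * psi N) by ring.
have : 2 * C * (N%:R^-1 * psi N) <= 2 * C * 10 by rewrite ler_wpM2l // mulr_ge0.
lra.
Qed.

(* Selberg's weights: summing mu(k) log(N/k) over k | n gives Lambda(n), plus
   log N when n = 1. *)
Lemma dens_of_vanishing :
  (forall n N, (0 < n)%N -> (0 < N)%N ->
     `|\sum_(1 <= m < N.+1) u (n * m)%N / m%:R| <= C / N%:R) ->
  dens u (- u 1%N).
Proof.
move=> htu.
have C0 : 0 <= C by have := htu 1%N 1%N isT isT; rewrite divr1; apply: le_trans.
exists (2 * C) => N N0.
have N0' : 0 < N%:R :> R by rewrite ltr0n.
have := hyperbola_mul (fun m => moebius m * (ln N%:R - ln m%:R)) u N.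
rewrite (eq_big_nat _ _ (F2 := fun k => u k / k%:R * ((k == 1%N)%:R * ln N%:R + mangoldt k))); last first.
  move=> k /andP[k0 kN]; congr (_ * _).
  rewrite -(@moebius_sum k N) // -[mangoldt k]opprK -(@moebius_sum_ln k N) // mulr_suml -sumrB.
  by apply: eq_bigr => m _; rewrite mulrBr.
move=> E.
have -> : \sum_(1 <= n < N.+1) mangoldt n / n%:R * u n - - u 1%N * ln N%:R
   = \sum_(1 <= k < N.+1) (u k / k%:R * ((k == 1%N)%:R * ln N%:R + mangoldt k)).
  under [RHS]eq_bigr => k _ do rewrite mulrDr.
  rewrite big_split /= addrC mulNr opprK; congr (_ + _); first by apply: eq_bigr => k _; ring.
  rewrite (bigD1_seq 1%N) ?iota_uniq //=; last by rewrite mem_index_iota.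
  by rewrite divr1 mul1r big1 ?addr0 // => k /negbTE ->; rewrite mul0r mulr0.
rewrite E; apply: le_trans (_ : \sum_(1 <= m < N.+1) 2 * C / N%:R * (ln N%:R - ln m%:R) <= _).
  apply: norm_sum_nat => m /andP[m0 mN].
  have q0 : (0 < N %/ m)%N by rewrite divn_gt0.
  have m0' : 0 < m%:R :> R by rewrite ltr0n.
  have h := @inv_floor_le N m; rewrite m0 -ltnS mN in h.
  have l0 : 0 <= ln N%:R - ln m%:R by rewrite subr_ge0 ler_ln_nat.
  rewrite !normrM (ger0_norm l0) normfV (ger0_norm (ltW m0')).
  apply: le_trans (_ : 1 * (ln N%:R - ln m%:R) / m%:R * (C * (2 * m%:R / N%:R)) <= _).
    apply: ler_pM => //; first by rewrite mulr_ge0 ?mulr_ge0 ?invr_ge0 ?normr_ge0 // ltW.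
      by rewrite ler_wpM2r ?invr_ge0 ?(ltW m0') // ler_wpM2r ?moebius_norm.
    apply: le_trans (htu _ _ m0 q0) _.
    by rewrite ler_wpM2l // h.
  by apply: eq_imp_le; field; rewrite !gt_eqF.
rewrite -mulr_sumr sumrB sumr_const_nat subSS subn0 -mulr_natl.
(* The sum of log (N/m) over m <= N is at most N by this bound. Thus the weights log (N/m) lose no
   logarithm and the error stays bounded. *)
have h := ln_fact_ge N.
rewrite mulrAC ler_pdivrMr // ler_wpM2l ?mulr_ge0 //.
lra.
Qed.
End Twisted.

(** * Nonvanishing of L(1) for real characters *)

Lemma bernoulli_ge (t : R) (n : nat) : 0 <= t <= 1 -> 1 - n%:R * t <= (1 - t) ^+ n.
Proof.
move=> /andP[t0 t1]; elim: n => [|n IH]; first by rewrite mul0r subr0 expr0.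
rewrite exprS; apply: le_trans (_ : (1 - t) * (1 - n%:R * t) <= _).
  rewrite -natr1; have : 0 <= n%:R * t * t by rewrite !mulr_ge0.
  by set y := n%:R; lra.
by rewrite ler_wpM2l // subr_ge0.
Qed.

Lemma bernoulli_le (t : R) (n : nat) : 0 <= t <= 1 -> (1 - t) ^+ n * (1 + n%:R * t) <= 1.
Proof.
move=> /andP[t0 t1]; elim: n => [|n IH]; first by rewrite mul0r expr0 addr0 mul1r.
apply: le_trans IH; rewrite exprSr -mulrA ler_wpM2l ?exprn_ge0 ?subr_ge0 //.
rewrite -natr1; have : 0 <= n%:R * t * t by rewrite !mulr_ge0.
have : 0 <= t * t by rewrite mulr_ge0.
by set y := n%:R; lra.
Qed.

(* Monsky's argument: the Lambert series of a real character stays bounded as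
   x -> 1 if L(1) = 0, but its power series coefficients are nonnegative, and at
   least 1 at the squares. *)
Section Monsky.
Variable x : R.
Hypothesis x01 : 0 < x < 1.
Let x0 : 0 < x. Proof. by case/andP: x01. Qed.
Let x1 : x < 1. Proof. by case/andP: x01. Qed.

Let S (n : nat) : R := \sum_(0 <= i < n) x ^+ i.

Let S_geo (n : nat) : (1 - x) * S n = 1 - x ^+ n.
Proof.
elim: n => [|n IH]; first by rewrite /S big_geq // mulr0 expr0 subrr.
rewrite /S big_nat_recr //= -/(S n) mulrDr IH exprS; ring.
Qed.

Let S_rec (n : nat) : S n.+1 = S n + x ^+ n.
Proof. by rewrite /S big_nat_recr. Qed.

Let S_rec' (n : nat) : S n.+1 = 1 + x * S n.
Proof.
rewrite /S big_nat_recl // expr0 mulr_sumr; congr (_ + _).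
by apply: eq_bigr => i _; rewrite exprS.
Qed.

Let S_ge0 (n : nat) : 0 <= S n.
Proof. by apply: sumr_ge0 => i _; rewrite exprn_ge0 // ltW. Qed.

Let S_gt0 (n : nat) : 0 < S n.+1.
Proof. by rewrite S_rec ltr_wpDl // exprn_gt0. Qed.

Let amgm (a b c : R) : 0 <= a -> 0 <= b -> 0 <= c -> a * b = c ^+ 2 -> 2 * c <= a + b.
Proof.
move=> a0 b0 c0 E; have h : 0 <= (a - b) ^+ 2 by rewrite sqr_ge0.
rewrite -ler_sqr ?nnegrE ?mulr_ge0 ?addr_ge0 //; rewrite !expr2 in E h *; nra.
Qed.

(* The reflection i -> 2n+1-i pairs the terms of the two sums. *)
Let S_pair (n : nat) :
  2 * n.+1%:R * x ^+ n.+1 <= S n.+1 + x ^+ n.+1 + x ^+ n.+2 * S n.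
Proof.
have -> : S n.+1 + x ^+ n.+1 + x ^+ n.+2 * S n = \sum_(0 <= i < n.+1) (x ^+ i + x ^+ (n + n.+1 - i)).
  rewrite big_split /= -addrA; congr (_ + _).
  rewrite [RHS]big_nat_rev /= big_nat_recl // mulr_sumr add0n subn1 /=.
  congr (_ + _); first by congr (x ^+ _); lia.
  by apply: eq_big_nat => i /andP[_ ilt]; rewrite -exprD; congr (x ^+ _); lia.
have -> : 2 * n.+1%:R * x ^+ n.+1 = \sum_(0 <= i < n.+1) 2 * x ^+ n.+1.
  by rewrite sumr_const_nat subn0 -mulr_natl; ring.
apply: ler_sum_nat => i /andP[_ ilt].
apply: le_trans (_ : x ^+ i.+1 + x ^+ (n + n.+1 - i) <= _).
  apply: amgm; rewrite ?exprn_ge0 ?(ltW x0) // -exprD -exprM; congr (x ^+ _); lia.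
by rewrite lerD2r exprS ler_piMl ?exprn_ge0 // ltW.
Qed.

(** After clearing denominators, this is exactly the monotonicity of the weights [c] defined
    next. *)
Let S_prod (n : nat) : n%:R * n.+1%:R * x ^+ n <= S n * S n.+1.
Proof.
elim: n => [|n IH]; first by rewrite !mul0r mulr_ge0.
have -> : S n.+1 * S n.+2 = x * (S n * S n.+1) + (S n.+1 + x ^+ n.+1 + x ^+ n.+2 * S n).
  by rewrite [S n.+2]S_rec {1}S_rec' !exprS; ring.
have := S_pair n; have : x * (n%:R * n.+1%:R * x ^+ n) <= x * (S n * S n.+1) by rewrite ler_pM2l.
rewrite exprS -[n.+2%:R]natr1 -[n.+1%:R]natr1.
set y := n%:R; set z := x ^+ n; set w := S n * _; set v := _ + _ * S n; lra.
Qed.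

(** The Lambert kernel x^n / (1 - x^n) behaves like 1 / (n (1 - x)); this is the discrepancy. It is
    nonnegative and decreasing with c 1 = 1 for every x, so summation by parts bounds its
    contribution uniformly as x tends to 1. *)
Let c (n : nat) : R := (n%:R * (1 - x))^-1 - x ^+ n / (1 - x ^+ n).

Let cE (n : nat) : c n.+1 = (1 - x)^-1 * (n.+1%:R^-1 - x ^+ n.+1 / S n.+1).
Proof.
have h : 1 - x != 0 by rewrite subr_eq0 eq_sym lt_eqF.
have h2 : S n.+1 != 0 by rewrite gt_eqF.
rewrite /c -S_geo !invfM; ring.
Qed.

Let c_anti (n : nat) : c n.+2 <= c n.+1.
Proof.
have sx : 0 < 1 - x by rewrite subr_gt0.
rewrite !cE ler_pM2l ?invr_gt0 //.
have s1 := S_gt0 n; have s2 := S_gt0 n.+1.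
have E : S n.+2 - x * S n.+1 = 1 by rewrite [S n.+2]S_rec'; ring.
have n1 : 0 < n.+1%:R :> R by rewrite ltr0n.
have n2 : 0 < n.+2%:R :> R by rewrite ltr0n.
have nE : n.+2%:R = n.+1%:R + 1 :> R by rewrite natr1.
have h := S_prod n.+1.
move: s1 s2 E h n1 n2 nE; set a := S n.+1; set b := S n.+2.
rewrite [x ^+ n.+2]exprS; set z := x ^+ n.+1; set p : R := n.+1%:R; set q : R := n.+2%:R.
move: a b z p q => a b z p q s1 s2 E h n1 n2 nE.
rewrite -subr_ge0.
have -> : p^-1 - z / a - (q^-1 - x * z / b) = (a * b * (q - p) - p * q * z * (b - x * a)) / (a * b * p * q).
  by field; rewrite !gt_eqF.
rewrite E nE addrAC subrr add0r !mulr1 divr_ge0 ?subr_ge0 -?nE //.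
by rewrite !mulr_ge0 // ltW.
Qed.

Let c_ge0 (n : nat) : 0 <= c n.+1.
Proof.
have sx : 0 < 1 - x by rewrite subr_gt0.
rewrite cE mulr_ge0 ?invr_ge0 ?(ltW sx) // subr_ge0 ler_pdivrMr //.
rewrite mulrC ler_pdivlMr ?ltr0n //.
have -> : x ^+ n.+1 * n.+1%:R = \sum_(0 <= i < n.+1) x ^+ n.+1.
  by rewrite sumr_const_nat subn0 mulr_natr.
by apply: ler_sum_nat => i /andP[_ h]; rewrite ler_wiXn2l ?(ltW x0) ?(ltW x1) // ltnW.
Qed.

Let c1 : c 1 = 1.
Proof.
have h : 1 - x != 0 by rewrite subr_eq0 eq_sym lt_eqF.
by rewrite /c mul1r expr1; field.
Qed.

Lemma lambert_upper (a : nat -> R) (B C : R) (M : nat) : (0 < M)%N ->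
  (forall i j, `|\sum_(i <= m < j) a m| <= B) ->
  `|\sum_(1 <= m < M.+1) a m / m%:R| <= C / M%:R ->
  \sum_(1 <= n < M.+1) a n * (x ^+ n / (1 - x ^+ n)) <= B + C / (M%:R * (1 - x)).
Proof.
move=> M0 hB hC.
have sx : 0 < 1 - x by rewrite subr_gt0.
have := @abel_bound a c B 1 M.+1 isT (fun m _ => hB 1%N m).
rewrite c1 mulr1 => h.
have {h} h : `|\sum_(1 <= i < M.+1) a i * c i| <= B.
  by apply: h; [case=> // n _; apply: c_anti|apply: c_ge0].
have -> : \sum_(1 <= n < M.+1) a n * (x ^+ n / (1 - x ^+ n))
   = (\sum_(1 <= m < M.+1) a m / m%:R) / (1 - x) - \sum_(1 <= i < M.+1) a i * c i.
  rewrite mulr_suml -sumrB; apply: eq_bigr => i _; rewrite /c invfM; ring.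
have h2 : (\sum_(1 <= m < M.+1) a m / m%:R) / (1 - x) <= C / (M%:R * (1 - x)).
  rewrite invfM mulrA ler_pM2r ?invr_gt0 //.
  by apply: le_trans hC; apply: ler_norm.
move: h; rewrite ler_norml => /andP[h _]; lra.
Qed.

(** Expand each x^n / (1 - x^n) geometrically and keep the exponents up to M. Each of the M
    remainders is at most x^M / (1 - x), whatever the sign of [a n]. *)
Lemma lambert_lower (a : nat -> R) (M : nat) :
  (forall n, `|a n| <= 1) ->
  \sum_(1 <= k < M.+1) (\sum_(1 <= m < M.+1 | (m %| k)%N) a m) * x ^+ k
    - M%:R * (x ^+ M / (1 - x))
  <= \sum_(1 <= n < M.+1) a n * (x ^+ n / (1 - x ^+ n)).
Proof.
move=> a1.
have sx : 0 < 1 - x by rewrite subr_gt0.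
have xn n : (0 < n)%N -> 1 - x <= 1 - x ^+ n.
  by move=> n0; rewrite lerD2l lerN2 -{2}[x]expr1 ler_wiXn2l ?(ltW x0) ?(ltW x1).
have tail n K : (0 < n)%N -> x ^+ n / (1 - x ^+ n)
   = \sum_(1 <= k < K.+1) x ^+ (n * k) + x ^+ (n * K.+1) / (1 - x ^+ n).
  move=> n0; have h : 1 - x ^+ n != 0 by rewrite gt_eqF // (lt_le_trans sx) ?xn.
  elim: K => [|K IH]; first by rewrite big_geq // add0r muln1.
  rewrite IH [in RHS]big_nat_recr //= -[RHS]addrA; congr (_ + _).
  rewrite [(n * K.+2)%N]mulnS exprD; move: h; set y := x ^+ n; set z := x ^+ _ => h.
  by field.
have E : \sum_(1 <= k < M.+1) (\sum_(1 <= m < M.+1 | (m %| k)%N) a m) * x ^+ k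
   = \sum_(1 <= n < M.+1) a n * \sum_(1 <= j < (M %/ n).+1) x ^+ (n * j).
  have := hyperbola (fun m j => a m * x ^+ (m * j)) M.
  under [RHS]eq_bigr => m _ do rewrite -mulr_sumr.
  move=> <-; apply: eq_bigr => k _; rewrite mulr_suml; apply: eq_bigr => m mk.
  by rewrite mulnC divnK.
have -> : M%:R * (x ^+ M / (1 - x)) = \sum_(1 <= n < M.+1) x ^+ M / (1 - x).
  by rewrite sumr_const_nat subSS subn0 mulr_natl.
rewrite E -sumrB; apply: ler_sum_nat => n /andP[n0 nM].
rewrite (tail n (M %/ n)%N n0) mulrDr lerD2l.
set y := x ^+ _ / (1 - x ^+ n).
have y0 : 0 <= y by rewrite divr_ge0 ?exprn_ge0 ?(ltW x0) // (le_trans (ltW sx)) ?xn.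
have yle : y <= x ^+ M / (1 - x).
  apply: ler_pM; rewrite ?exprn_ge0 ?(ltW x0) ?invr_ge0 //.
  - by rewrite (le_trans (ltW sx)) ?xn.
  - by rewrite ler_wiXn2l ?(ltW x0) ?(ltW x1) // mulnC ltnW // ltn_ceil.
  - by rewrite lef_pV2 ?posrE ?xn // (lt_le_trans sx) ?xn.
have := a1 n; rewrite ler_norml => /andP[h _].
have : -1 * y <= a n * y by rewrite ler_wpM2r.
lra.
Qed.
End Monsky.

Section RealCharacter.
Variable a : nat -> R.
Hypothesis aM : forall m n, a (m * n)%N = a m * a n.
Hypothesis a_1 : a 1%N = 1.
Hypothesis a_val : forall n, a n \in [:: 0; 1; -1].

Let D N n := \sum_(1 <= m < N.+1 | (m %| n)%N) a m.

(** The divisors of p^(v+1) n prime to p are those of n; the others are p times a divisor of p^v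
    n. *)
Let D_rec (p v n N : nat) : prime p -> ~~ (p %| n)%N -> (p ^ v.+1 * n <= N)%N ->
  D N (p ^ v.+1 * n) = D N n + a p * D N (p ^ v * n).
Proof.
move=> pp pn leN; have p0 := prime_gt0 pp.
have n0 : (0 < n)%N by case: n pn {leN} => //; rewrite dvdn0.
rewrite /D (bigID (fun k => (p %| k)%N)) /= addrC; congr (_ + _).
  apply: eq_bigl => k; apply/andP/idP => [[h1 h2]|h].
    by move: h1; rewrite Gauss_dvdr // coprimeXr // coprime_sym prime_coprime.
  by split; [exact: dvdn_mull|]; apply: contra pn => pk; apply: dvdn_trans h.
rewrite (eq_bigl (fun k => (p %| k)%N && (k %| p ^ v.+1 * n)%N)); last by move=> k; rewrite andbC.
rewrite big_mkcondr sum_multiples //= mulr_sumr.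
rewrite [RHS](_ : _ = \sum_(1 <= j < (N %/ p).+1 | (j %| p ^ v * n)%N) a p * a j).
  rewrite [RHS]big_mkcond /=; apply: eq_bigr => j _.
  by rewrite expnS -mulnA dvdn_pmul2l // aM.
rewrite [RHS](@big_nat_widen _ _ _ 1 (N %/ p).+1 N.+1); last by rewrite ltnS leq_div.
apply: eq_bigl => k; rewrite andb_idr // => kn.
have k_le : (k <= p ^ v * n)%N by apply: dvdn_leq kn; rewrite muln_gt0 expn_gt0 p0.
by rewrite ltnS; apply: leq_trans k_le _; rewrite leq_divRL // mulnAC -expnSr.
Qed.

(** For a p = 0, 1, -1 the local factor is 1, v + 1, or alternately 1 and 0: always nonnegative, and
    at least 1 for even v. *)
Let D_pow (p v n N : nat) : prime p -> ~~ (p %| n)%N -> (p ^ v * n <= N)%N ->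
  0 <= D N n -> 0 <= D N (p ^ v * n) /\ (~~ odd v -> D N n <= D N (p ^ v * n)).
Proof.
move=> pp pn leN Dn.
have : a p \in [:: 0; 1; -1] := a_val p.
have hv v' : (v' <= v)%N -> (p ^ v' * n <= N)%N.
  move=> h; apply: leq_trans leN; rewrite leq_mul2r leq_exp2l ?h ?orbT //.
  exact: prime_gt1.
rewrite !inE => /or3P[] /eqP ap.
- case: v leN hv => [|v] leN _; first by rewrite expn0 mul1n.
  by rewrite D_rec // ap mul0r addr0.
- have h w : (w <= v)%N -> D N n <= D N (p ^ w * n).
    elim: w => [|w IH] wv; first by rewrite expn0 mul1n.
    rewrite D_rec ?hv // ap mul1r lerDl; apply: le_trans (IH _) => //; exact: ltnW.
  by split=> [|_]; [apply: le_trans (h v _)|apply: h].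
have h w : (w <= v)%N -> D N (p ^ w * n) = if odd w then 0 else D N n.
  elim: w => [|w IH] wv; first by rewrite expn0 mul1n.
  rewrite D_rec ?hv // ap IH ?(ltnW wv) //=; case: (odd w) => /=; first by rewrite mulr0 addr0.
  by rewrite mulN1r subrr.
by rewrite h //; case: (odd v).
Qed.

Let D_ge0 (n N : nat) : (0 < n <= N)%N -> 0 <= D N n.
Proof.
elim/ltn_ind: n => n IH /andP[n0 nN].
have [n1|n1] := leqP n 1.
  have -> : n = 1%N by apply/eqP; rewrite eqn_leq n1 n0.
  apply: sumr_ge0 => m; rewrite dvdn1 => /eqP ->; by rewrite a_1.
have [p [v [m [pp pm nE /andP[m0 mn]]]]] := prime_factorization_step n1.
rewrite nE; apply: (D_pow _ _ _ _).1 => //; first by rewrite -nE.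
by apply: IH => //; rewrite m0 (leq_trans (ltnW mn)).
Qed.

Let D_square (m N : nat) : (0 < m)%N -> (m ^ 2 <= N)%N -> 1 <= D N (m ^ 2).
Proof.
elim/ltn_ind: m => m IH m0 mN.
have [m1|m1] := leqP m 1.
  have E : m = 1%N by apply/eqP; rewrite eqn_leq m1 m0.
  rewrite E exp1n in mN *.
  rewrite /D big_mkcond (bigD1_seq 1%N) ?iota_uniq //=; last by rewrite mem_index_iota.
  rewrite a_1 big1 ?addr0 // => k; rewrite dvdn1.
  by case: (k == 1%N).
have [p [v [n [pp pn mE /andP[n0 nm]]]]] := prime_factorization_step m1.
have E2 : (m ^ 2 = p ^ (2 * v.+1) * n ^ 2)%N by rewrite mE expnMn -expnM mulnC [(_.+1 * 2)%N]mulnC mulnC.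
have nN : (n ^ 2 <= N)%N by apply: leq_trans mN; rewrite leq_exp2r // ltnW.
apply: le_trans (IH n nm n0 nN) _; rewrite E2; apply: (D_pow _ _ _ _).2 => //.
- by rewrite Euclid_dvdX // negb_and pn.
- by rewrite -E2.
- by apply: D_ge0; rewrite expn_gt0 n0.
- by rewrite mul2n odd_double.
Qed.

Lemma real_character_nonvanishing (B C : R) :
  (forall i j, `|\sum_(i <= m < j) a m| <= B) ->
  (forall M, (0 < M)%N -> `|\sum_(1 <= m < M.+1) a m / m%:R| <= C / M%:R) -> False.
Proof.
move=> hB hC.
have C0 : 0 <= C by have := hC 1%N isT; rewrite divr1; apply: le_trans.
suff key K : (0 < K)%N -> K%:R / 2 <= B + C + 16.
  have B0 : 0 <= B by have := hB 0%N 0%N; rewrite big_geq // normr0.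
  pose K := (Num.truncn (2 * (B + C + 16))).+1.
  have := key K isT; rewrite ler_pdivrMr // leNgt => /negP; apply.
  rewrite mulrC; apply: truncnS_gt.
(* Take x = 1 - 1/(2 K^2) and truncate at M = 2 K^6. *)
move=> K0; have K0' : 0 < K%:R :> R by rewrite ltr0n.
have K1 : 1 <= K%:R :> R by rewrite ler1n.
pose t : R := (2 * K%:R ^+ 2)^-1; pose x := 1 - t.
have K2 : 1 <= K%:R ^+ 2 :> R by rewrite exprn_ege1.
have t0 : 0 < t by rewrite invr_gt0 mulr_gt0 // exprn_gt0.
have t12 : t <= 1 / 2.
  by rewrite /t invfM mul1r ler_piMr ?invr_ge0 // invf_le1 // exprn_gt0.
have x01 : 0 < x < 1 by rewrite /x; apply/andP; split; lra.
have tE : 1 - x = t by rewrite /x; ring.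
have tt : 0 <= t <= 1 by apply/andP; split; lra.
pose M := (2 * K ^ 6)%N.
have M0 : (0 < M)%N by rewrite muln_gt0 expn_gt0 K0.
have h1 := lambert_upper x01 M0 hB (hC M M0).
have a1 n : `|a n| <= 1.
  by have := a_val n; rewrite !inE => /or3P[] /eqP ->; rewrite ?normr0 ?normrN ?normr1 ?ler01.
have h2 := lambert_lower x01 M a1.
have lo : K%:R / 2 <= \sum_(1 <= k < M.+1) (\sum_(1 <= m < M.+1 | (m %| k)%N) a m) * x ^+ k.
  (* Only the squares j^2 with j <= K are kept; each has x^(j^2) >= x^(K^2) >= 1 - K^2 t = 1/2. *)
  apply: le_trans (_ : \sum_(1 <= j < K.+1) x ^+ (j ^ 2) <= _).
    have -> : K%:R / 2 = \sum_(1 <= j < K.+1) (1 / 2 : R).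
      by rewrite sumr_const_nat subSS subn0 -[RHS]mulr_natl div1r.
    apply: ler_sum_nat => j /andP[j0 jK].
    apply: le_trans (_ : x ^+ (K ^ 2) <= _).
      apply: le_trans (bernoulli_ge (K ^ 2) tt).
      rewrite natrX /t invfM mulrCA mulfV ?gt_eqF ?exprn_gt0 // mulr1; lra.
    by case/andP: x01 => xx0 xx1; rewrite ler_wiXn2l ?(ltW xx0) ?(ltW xx1) // leq_exp2r.
  have xx n : 0 <= x ^+ n by rewrite exprn_ge0 //; case/andP: x01 => /ltW.
  pose g k : R := \sum_(1 <= j < K.+1) (if k == (j ^ 2)%N then x ^+ k else 0).
  apply: le_trans (_ : \sum_(1 <= k < M.+1) g k <= _).
    rewrite /g exchange_big_nat /=; apply: ler_sum_nat => j /andP[j0 jK].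
    have jM : (j ^ 2)%N \in index_iota 1 M.+1.
      rewrite mem_index_iota expn_gt0 j0 /= ltnS (@leq_trans (K ^ 2)) //.
        by rewrite leq_exp2r.
      by rewrite (@leq_trans (K ^ 6)) ?leq_pexp2l // leq_pmull.
    rewrite (bigD1_seq _ jM) ?iota_uniq //= eqxx big1 ?addr0 // => k.
    by move=> /negbTE ->.
  apply: ler_sum_nat => k /andP[k0 kM]; rewrite -/(D M k).
  have Dk : 0 <= D M k by apply: D_ge0; rewrite k0.
  have [/hasP[j]|/hasPn hn] := boolP (has (fun j => k == (j ^ 2)%N) (index_iota 1 K.+1)).
    rewrite mem_index_iota => /andP[j0 jK] /eqP kE.
    rewrite /g (bigD1_seq j) ?iota_uniq ?mem_index_iota ?j0 //= kE eqxx big1 ?addr0.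
      by rewrite ler_peMl // D_square // -kE.
    move=> i ij; case: eqP => // /eqP; rewrite eqn_exp2r // => /eqP E.
    by rewrite E eqxx in ij.
  rewrite /g big_seq_cond big1 ?mulr_ge0 // => j; rewrite andbT => /hn /negbTE -> //.
have r1 : C / (M%:R * (1 - x)) <= C.
  rewrite ler_piMr // invf_le1.
    rewrite tE /t /M natrM natrX -[K%:R ^+ 6]/(K%:R ^+ (4 + 2)) exprD.
    move: (K%:R ^+ 2) K2 (exprn_ege1 4 K1) => y K2 y4.
    have y0 : 0 < y by lra.
    have -> : 2 * (K%:R ^+ 4 * y) / (2 * y) = K%:R ^+ 4 by field; rewrite gt_eqF.
    by [].
  by rewrite mulr_gt0 ?ltr0n // tE.
(* With z = x^(K^6), [bernoulli_le] gives z K^4 <= 2. The exponent M is twice K^6 so that x^M = z^2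
   absorbs the factor M / t = 4 K^8, leaving 4 times 2^2. *)
have r2 : M%:R * (x ^+ M / (1 - x)) <= 16.
  have := bernoulli_le (K ^ 6) tt; rewrite -/x => hb.
  have -> : x ^+ M = (x ^+ (K ^ 6)) ^+ 2 by rewrite -exprM mulnC.
  have xx : 0 <= x ^+ (K ^ 6) by rewrite exprn_ge0 //; case/andP: x01 => /ltW.
  move: (x ^+ (K ^ 6)) xx hb => z z0.
  rewrite tE /M natrM !natrX /t invrK -[K%:R ^+ 6]/(K%:R ^+ (2 * 3)) exprM.
  move: (K%:R ^+ 2) K2 => y K2.
  have y0 : 0 < y by lra.
  have -> : y ^+ 3 / (2 * y) = y ^+ 2 / 2 by field; rewrite gt_eqF.
  move=> hb.
  have h : z * y ^+ 2 <= 2 by lra.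
  have hh : 0 <= z * y ^+ 2 by rewrite mulr_ge0 // sqr_ge0.
  have -> : 2 * y ^+ 3 * (z ^+ 2 * (2 * y)) = 4 * (z * y ^+ 2) ^+ 2 by ring.
  by rewrite expr2; move: (z * _) h hh => w h hh; nra.
lra.
Qed.
End RealCharacter.

(** * Dirichlet's theorem on primes in arithmetic progressions *)

Lemma dens_ext (v w : nat -> R) (c : R) : v =1 w -> dens v c -> dens w c.
Proof.
move=> vw [C hC]; exists C => N N0; apply: le_trans (hC N N0).
by under eq_bigr => n _ do rewrite -vw.
Qed.

Lemma densD (v w : nat -> R) (c e : R) :
  dens v c -> dens w e -> dens (fun n => v n + w n) (c + e).
Proof.
move=> [C hC] [E hE]; exists (C + E) => N N0.
have -> : \sum_(1 <= n < N.+1) mangoldt n / n%:R * (v n + w n) - (c + e) * ln N%:R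
  = (\sum_(1 <= n < N.+1) mangoldt n / n%:R * v n - c * ln N%:R)
    + (\sum_(1 <= n < N.+1) mangoldt n / n%:R * w n - e * ln N%:R).
  by under eq_bigr => n _ do rewrite mulrDr; rewrite big_split /=; ring.
by apply: le_trans (ler_normD _ _) _; apply: lerD; [apply: hC|apply: hE].
Qed.

Lemma densZ (v : nat -> R) (a c : R) : dens v c -> dens (fun n => a * v n) (a * c).
Proof.
move=> [C hC]; exists (`|a| * C) => N N0.
have -> : \sum_(1 <= n < N.+1) mangoldt n / n%:R * (a * v n) - a * c * ln N%:R
  = a * (\sum_(1 <= n < N.+1) mangoldt n / n%:R * v n - c * ln N%:R).
  rewrite mulrBr mulr_sumr mulrA; congr (_ - _); apply: eq_bigr => n _; ring.
by rewrite normrM ler_wpM2l // hC.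
Qed.

Lemma dens0 : dens (fun=> 0) 0.
Proof. by exists 0 => N _; rewrite big1 ?mul0r ?subr0 ?normr0 // => n _; rewrite mulr0. Qed.

Lemma dens_sum (I : finType) (v : I -> nat -> R) (c : I -> R) :
  (forall i, dens (v i) (c i)) -> dens (fun n => \sum_i v i n) (\sum_i c i).
Proof.
move=> h; suff H (s : seq I) : dens (fun n => \sum_(i <- s) v i n) (\sum_(i <- s) c i) by [].
elim: s => [|i s IH].
  by rewrite big_nil; apply: dens_ext dens0 => n; rewrite big_nil.
by rewrite big_cons; apply: dens_ext (densD (h i) IH) => n; rewrite big_cons.
Qed.

Lemma ln_unbounded (B : R) : exists2 N, (0 < N)%N & B < ln N%:R.
Proof.
have h k : k%:R / 2 <= ln (2 ^ k)%:R :> R.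
  elim: k => [|k IH]; first by rewrite mul0r expn0 ln_1.
  rewrite expnS ln_natM ?expn_gt0 //.
  have := @ln_ge_1subV 2; rewrite ltr0n => /(_ isT); rewrite -[k.+1%:R]natr1; lra.
exists (2 ^ (Num.truncn (2 * B)).+1)%N; first by rewrite expn_gt0.
apply: lt_le_trans (h _); rewrite ltr_pdivlMr // mulrC; exact: truncnS_gt.
Qed.

Lemma dens_unique (v : nat -> R) (c e : R) : dens v c -> dens v e -> c = e.
Proof.
move=> [C hC] [E hE]; apply/eqP; rewrite -subr_eq0; apply: contraT => ce.
have [N N0] := ln_unbounded ((C + E) / `|c - e|).
rewrite ltr_pdivrMr ?normr_gt0 // => h.
have := hC N N0; have := hE N N0; set S := \sum_(_ <= _ < _) _ => h1 h2.
have := le_lt_trans (le_trans (ler_normB _ _) (lerD h1 h2)).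
rewrite [E + C]addrC => /(_ _ h).
have -> : S - e * ln N%:R - (S - c * ln N%:R) = ln N%:R * (c - e) by ring.
by rewrite normrM ger0_norm ?ltxx // ln_nat_ge0.
Qed.

Lemma dens_le (v w : nat -> R) : (forall n, 0 <= w n <= v n) -> dens v 0 -> dens w 0.
Proof.
move=> wv [C hC]; exists C => N N0; apply: le_trans (hC N N0).
have L0 n : 0 <= mangoldt n / n%:R by rewrite divr_ge0 ?mangoldt_ge0.
have w0 n : 0 <= w n by have /andP[] := wv n.
have v0 n : 0 <= v n by have /andP[h1 h2] := wv n; apply: le_trans h2.
have nonneg (f : nat -> R) : (forall n, 0 <= f n) -> 0 <= \sum_(1 <= n < N.+1) mangoldt n / n%:R * f n.
  by move=> f0; apply: sumr_ge0 => n _; rewrite mulr_ge0.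
rewrite !mul0r !subr0 !ger0_norm ?nonneg //.
apply: ler_sum => n _; have /andP[_ wv'] := wv n.
by rewrite ler_wpM2l.
Qed.

Section Dirichlet.
Variable k : nat.
Local Notation d := k.+2.
Local Notation G := {unit 'Z_d}.

(** For n not coprime to d the value is the default 1, which [ext] masks by 0. *)
Definition unit_class (n : nat) : G := insubd (1%g : G) (n%:R : 'Z_d).

Definition ext (u : G -> R) (n : nat) : R := if coprime d n then u (unit_class n) else 0.

Lemma val_unit_class (n : nat) : coprime d n -> val (unit_class n) = n%:R.
Proof. by move=> h; rewrite insubdK // -topredE /= unitZpE. Qed.

Lemma unit_classM (m n : nat) : coprime d m -> coprime d n ->
  unit_class (m * n) = (unit_class m * unit_class n)%g.
Proof.
move=> hm hn; apply: val_inj.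
by rewrite FinRing.val_unitM !val_unit_class ?coprimeMr ?hm // natrM.
Qed.

Lemma unit_class1 : unit_class 1 = 1%g.
Proof. by apply: val_inj; rewrite val_unit_class ?coprimen1. Qed.

Lemma Zp_unit_mulC (g h : G) : (g * h = h * g)%g.
Proof. by apply: val_inj; rewrite !FinRing.val_unitM mulrC. Qed.

Lemma ext_mul (u : G -> R) (n m : nat) : coprime d n ->
  ext u (n * m) = ext (fun g => u (unit_class n * g)%g) m.
Proof.
move=> hn; rewrite /ext coprimeMr hn /=; case: ifP => // hm.
by rewrite unit_classM.
Qed.

Lemma sum_translate (F : G -> R) (h : G) : \sum_g F (h * g)%g = \sum_g F g.
Proof. by rewrite [RHS](reindex_inj (mulgI h)). Qed.

Lemma sum_ext (u : G -> R) : \sum_(0 <= i < d) ext u i = \sum_g u g.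
Proof.
rewrite big_mkord.
have -> : \sum_(i < d) ext u i =
   \sum_(x : 'Z_d | x \is a GRing.unit) u (insubd (1%g : G) x).
  rewrite [RHS]big_mkcond /=; apply: eq_bigr => x _.
  rewrite /ext /unit_class -(@unitZpE d x) // natr_Zp //.
rewrite (reindex_onto (val : G -> 'Z_d) (insubd (1%g : G))) /=; last first.
  by move=> x xu; rewrite insubdK.
apply: eq_big => [g|g _]; last by rewrite valKd.
by rewrite (valP g) valKd eqxx.
Qed.

Let nrm (u : G -> R) : R := \sum_g `|u g|.

Let nrm_ge0 (u : G -> R) : 0 <= nrm u.
Proof. exact: sumr_ge0. Qed.

(** Multiplication by a unit permutes G, so full periods sum to 0 and an initial segment reduces to
    less than one period; the 2 comes from subtracting two initial segments. *)
Lemma ext_bound (u : G -> R) (n a b : nat) : \sum_g u g = 0 ->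
  `|\sum_(a <= m < b) ext u (n * m)| <= 2 * nrm u.
Proof.
move=> u0; have [ncop|ncop] := boolP (coprime d n); last first.
  rewrite big1 ?normr0 ?mulr_ge0 // => m _.
  by rewrite /ext coprimeMr (negbTE ncop).
under eq_bigr => m _ do rewrite ext_mul //.
set w := fun g => u _; have w0 : \sum_g w g = 0 by rewrite sum_translate.
have wu : nrm u = nrm w by rewrite /nrm -(sum_translate _ (unit_class n)).
have pre N : `|\sum_(0 <= m < N) ext w m| <= nrm u.
  elim/ltn_ind: N => N IH; have [Nd|dN] := ltnP N d.
    apply: le_trans (ler_norm_sum _ _ _) _.
    apply: le_trans (@sum_nat_mono (fun m => `|ext w m|) predT 0 N d (ltnW Nd) _) _ => //.
    rewrite wu /nrm -sum_ext; apply: ler_sum_nat => i _.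
    by rewrite /ext; case: ifP; rewrite ?normr0.
  rewrite (@big_cat_nat _ _ _ d) //= sum_ext w0 add0r -{1}[d]add0n big_addn.
  have -> : \sum_(0 <= i < N - d) ext w (i + d) = \sum_(0 <= i < N - d) ext w i.
    apply: eq_bigr => i _; rewrite /ext /unit_class natrD char_Zp // addr0.
    by rewrite /coprime gcdnDr.
  by apply: IH; rewrite ltn_subrL /= (leq_trans _ dN).
have [ab|ba] := leqP a b; last by rewrite big_geq ?normr0 ?mulr_ge0 // ltnW.
have -> : \sum_(a <= m < b) ext w m = \sum_(0 <= m < b) ext w m - \sum_(0 <= m < a) ext w m.
  by rewrite [X in _ = X - _](@big_cat_nat _ _ _ a) //= addrAC subrr add0r.
apply: le_trans (ler_normB _ _) _; have := pre a; have := pre b; lra.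
Qed.

Let delta (h g : G) : R := (g == h)%:R.
(** A function u of sum 0 equals the sum over h of u h times [e h], so convergence of the series of
    u(m)/m only has to be established for these functions. *)
Let e (h g : G) : R := delta h g - #|{: G}|%:R^-1.

Let cardG_gt0 : 0 < #|{: G}|%:R :> R.
Proof. by rewrite ltr0n; apply/card_gt0P; exists 1%g. Qed.

Let sum_delta (F : G -> R) (h : G) : \sum_g F g * delta g h = F h.
Proof.
rewrite (bigD1 h) //= /delta eqxx mulr1 big1 ?addr0 // => g /negbTE.
by rewrite eq_sym => ->; rewrite mulr0.
Qed.

Let sum_e (h : G) : \sum_g e h g = 0.
Proof.
rewrite sumrB (bigD1 h) //= {1}/delta eqxx big1; last by move=> g /negbTE; rewrite /delta => ->.
by rewrite addr0 sumr_const -[X in _ - X]mulr_natr mulVf ?subrr // gt_eqF.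
Qed.

Let L_exists : exists c : G -> R, forall h N, (0 < N)%N ->
  `|c h - \sum_(1 <= m < N.+1) ext (e h) m / m%:R| <= 2 * nrm (e h) / N%:R.
Proof.
apply: (fin_all_exists (P := fun h x => forall N, (0 < N)%N ->
  `|x - \sum_(1 <= m < N.+1) ext (e h) m / m%:R| <= 2 * nrm (e h) / N%:R)) => h.
apply: cauchy_rate => M N M0 MN.
rewrite (@big_cat_nat _ _ _ M.+1) //= addrAC subrr add0r.
apply: le_trans (abel_bound (B := 2 * nrm (e h)) (c := fun m => m%:R^-1) _ _ _ _) _ => //.
- move=> m _; have := @ext_bound (e h) 1 M.+1 m (sum_e h).
  by under eq_bigr do rewrite mul1n.
- move=> n /andP[Mn _]; rewrite lef_pV2 ?posrE ?ltr0n ?ler_nat //.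
  exact: leq_ltn_trans Mn.
- by rewrite invr_ge0.
rewrite ler_wpM2l ?mulr_ge0 // lef_pV2 ?posrE ?ltr0n // ler_nat //.
Qed.

Section WithL.
Variable c : G -> R.
Hypothesis hc : forall h N, (0 < N)%N ->
  `|c h - \sum_(1 <= m < N.+1) ext (e h) m / m%:R| <= 2 * nrm (e h) / N%:R.

(* T u g is the conditionally convergent sum of u(g m)/m over m coprime to d,
   for u of sum 0. *)
Let T (u : G -> R) (g : G) : R := \sum_h u (g * h)%g * c h.

Let bnd (u : G -> R) : R := nrm u * \sum_h 2 * nrm (e h).

Let bnd_ge0 (u : G -> R) : 0 <= bnd u.
Proof. by rewrite mulr_ge0 // sumr_ge0 // => h _; rewrite mulr_ge0. Qed.

(** Expand the translate of u by the class of n along the functions [e h]. The coefficients are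
    values of u, whence a rate independent of n. *)
Let T_approx (u : G -> R) (n N : nat) : \sum_g u g = 0 -> (0 < N)%N ->
  `|ext (T u) n - \sum_(1 <= m < N.+1) ext u (n * m) / m%:R| <= bnd u / N%:R.
Proof.
move=> u0 N0; have [ncop|ncop] := boolP (coprime d n); last first.
  rewrite big1 => [|m _]; last by rewrite /ext coprimeMr (negbTE ncop) /= mul0r.
  by rewrite /ext (negbTE ncop) subr0 normr0 divr_ge0.
set g := unit_class n.
have -> : \sum_(1 <= m < N.+1) ext u (n * m) / m%:R
   = \sum_h u (g * h)%g * \sum_(1 <= m < N.+1) ext (e h) m / m%:R.
  under [RHS]eq_bigr => h _ do rewrite mulr_sumr.
  rewrite exchange_big /=; apply: eq_bigr => m _.
  rewrite ext_mul // -/g /ext; case hm: (coprime d m); last first.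
    by rewrite mul0r big1 // => h _; rewrite mulr0.
  under eq_bigr => h _ do rewrite mulrA.
  rewrite -mulr_suml; congr (_ / _); rewrite /e.
  under eq_bigr => h _ do rewrite mulrBr.
  rewrite sumrB (sum_delta (fun h => u (g * h)%g)) -mulr_suml sum_translate u0.
  by rewrite mul0r subr0.
rewrite /ext ncop -/g /T -sumrB /bnd mulr_sumr mulr_suml.
apply: le_trans (ler_norm_sum _ _ _) _; apply: ler_sum => h _.
rewrite -mulrBr normrM -mulrA; apply: ler_pM => //; last exact: hc.
by rewrite /nrm (bigD1 (g * h)%g) //= lerDl sumr_ge0.
Qed.

Let dens_T (w : G -> R) : \sum_g w g = 0 -> dens (ext (T w)) 0.
Proof.
move=> w0; apply: (@dens_transform (ext w) (2 * nrm w) (bnd w)).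
  by move=> n a b _; apply: ext_bound.
by move=> n N _; apply: T_approx.
Qed.

Let kerT (u : G -> R) := \sum_g u g = 0 /\ forall g, T u g = 0.

Let kerT_translate (u : G -> R) (h : G) : kerT u -> kerT (fun g => u (h * g)%g).
Proof.
move=> [u0 Tu]; split; first by rewrite sum_translate.
move=> g; rewrite -(Tu (h * g)%g); apply: eq_bigr => x _.
by rewrite mulgA.
Qed.

Let dens_ker (u : G -> R) : kerT u -> dens (ext u) (- u 1%g).
Proof.
move=> [u0 Tu].
have -> : u 1%g = ext u 1 by rewrite /ext coprimen1 unit_class1.
apply: (@dens_of_vanishing (ext u) (bnd u)).
move=> n N _ N0; have := T_approx n u0 N0.
have -> : ext (T u) n = 0 by rewrite /ext Tu if_same.
by rewrite sub0r normrN.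
Qed.

Let ext_one : dens (ext (fun=> 1)) 1.
Proof.
apply: dens_ext (@dens_coprime d _) => // n.
by rewrite /ext; case: coprime.
Qed.

Let ext_sum (I : finType) (u : I -> G -> R) n :
  ext (fun g => \sum_i u i g) n = \sum_i ext (u i) n.
Proof. by rewrite /ext; case: ifP => // _; rewrite big1. Qed.

(* In fact every class has positive density: sparse classes do not exist. *)
Let sparse (g : G) : Prop := dens (ext (delta g)) 0.

(* The function v below is nonnegative and has density 0, since u(y .) has
   density - u y; so it vanishes at all classes that are not sparse. *)
Let ker_anti (u : G -> R) (g h : G) : kerT u -> ~ sparse g -> u (h * g)%g = - u h.
Proof.
move=> ku hg; pose v x := \sum_y (u y + u (y * x)%g) ^+ 2.
have v0 x : 0 <= v x by apply: sumr_ge0 => y _; rewrite sqr_ge0.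
have dv : dens (ext v) 0.
  pose s := \sum_y u y ^+ 2.
  have -> : 0 = 2 * s * 1 + 2 * \sum_y u y * (- u (y * 1)%g) :> R.
    under eq_bigr => y _ do rewrite mulg1 mulrN -expr2.
    by rewrite sumrN -/s; ring.
  have h1 := densZ (2 * s) ext_one.
  have h2 : dens (fun n => \sum_y u y * ext (fun g => u (y * g)%g) n)
      (\sum_y u y * (- u (y * 1)%g)).
    apply: dens_sum => y; apply: densZ; exact: (dens_ker (kerT_translate y ku)).
  apply: dens_ext (densD h1 (densZ 2 h2)) => n.
  rewrite /ext; case: ifP => _; last by rewrite big1 ?mulr0 ?addr0 // => y _; rewrite mulr0.
  set x := unit_class n; rewrite /v mulr1 mulr_sumr.
  have E : s = \sum_y u (y * x)%g ^+ 2.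
    rewrite /s -(sum_translate _ x); apply: eq_bigr => y _; by rewrite Zp_unit_mulC.
  rewrite mulr_natl mulr2n {2}E /s -!big_split /=; apply: eq_bigr => y _; ring.
have vg : v g = 0.
  apply/eqP; apply: contraT => vg; exfalso; apply: hg.
  have vg0 : 0 < v g by rewrite lt0r vg v0.
  have := densZ (v g)^-1 dv; rewrite mulr0; apply: dens_le => n.
  rewrite /ext; case: ifP => _; last by rewrite mulr0 lexx.
  rewrite /delta; case: eqP => [->|_]; first by rewrite mulVf // ler01 lexx.
  by rewrite lexx /= mulr_ge0 // invr_ge0 ltW.
have /eqP := vg; rewrite psumr_eq0 => [/allP/(_ h)|y _]; last exact: sqr_ge0.
by rewrite mem_index_enum sqrf_eq0 addr_eq0 => /(_ isT)/eqP ->; rewrite opprK.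
Qed.

Let exists_not_sparse : exists g, ~ sparse g.
Proof.
apply: contrapT => h.
have hs g : sparse g by apply: contrapT => hg; apply: h; exists g.
have := dens_sum hs; rewrite big1 // => h0.
suff : (1 : R) = 0 by move/eqP; rewrite oner_eq0.
apply: dens_unique ext_one (dens_ext _ h0) => n.
rewrite -ext_sum /ext; case: ifP => // _.
by under eq_bigr do rewrite -[delta _ _]mul1r; rewrite (sum_delta (fun=> 1)).
Qed.

(* For a class g that is not sparse, T w (h g) = T w h, so T w h = 0 because T w
   has density 0; ker_anti then gives w = - w. *)
Let invariant_zero (w : G -> R) (h0 : G) : \sum_g w g = 0 ->
  (forall g h, ~ sparse g -> w (h * g)%g = w h) -> w h0 = 0.
Proof.
move=> w0 winv.
have kw : kerT w.
  split=> // h; set t := T w h.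
  pose wh g := w (h * g)%g.
  have wh0 : \sum_g wh g = 0 by rewrite sum_translate.
  have hg g : dens (fun n => (t - T wh g) * ext (delta g) n) 0.
    have [hs|hs] := EM (sparse g); first by rewrite -[X in dens _ X](mulr0 (t - T wh g)); apply: densZ.
    have -> : t - T wh g = 0.
      apply/eqP; rewrite subr_eq0; apply/eqP; apply: eq_bigr => x _.
      by rewrite /wh [(g * x)%g]Zp_unit_mulC mulgA (winv g).
    by apply: dens_ext dens0 => n; rewrite mul0r.
  have := densD (dens_T wh0) (dens_sum hg); rewrite add0r big1 // => h1.
  apply: (@dens_unique (fun n => t * ext (fun=> 1) n)).
    by have := densZ t ext_one; rewrite mulr1.
  apply: dens_ext h1 => n; rewrite /ext; case: ifP => _; last first.
    by rewrite big1 ?mulr0 ?addr0 // => g _; rewrite mulr0.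
  by rewrite (sum_delta (fun g => t - T wh g)) mulr1; ring.
have [g gs] := exists_not_sparse.
have := ker_anti h0 kw gs; rewrite winv // => /eqP.
by rewrite -addr_eq0 -mulr2n mulrn_eq0 /= => /eqP.
Qed.

(* A nonzero u would be a multiple of a real character with L(1) = 0. *)
Let kerT_zero (u : G -> R) (g0 : G) : kerT u -> u g0 = 0.
Proof.
move=> ku; apply/eqP; apply: contraT => ug0; exfalso.
(* Moving h by a class that is not sparse changes the sign of both factors. The product, minus its
   mean over h, is thus invariant of sum 0 and vanishes by [invariant_zero]. *)
have prod h x : u h * u (h * x)%g = u 1%g * u x.
  pose f y := u y * u (y * x)%g.
  pose m := (\sum_y f y) / #|{: G}|%:R.
  have z y : f y - m = 0.
    apply: (@invariant_zero (fun y => f y - m)).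
      by rewrite sumrB sumr_const -[X in _ - X]mulr_natr divfK ?subrr // gt_eqF.
    move=> g h' gs; rewrite /f -mulgA [(g * x)%g]Zp_unit_mulC mulgA.
    by rewrite !(ker_anti _ ku gs) mulrNN.
  rewrite -{2}[x]mul1g -/(f h) -/(f 1%g).
  by rewrite -[f h](subrK m) -[f 1%g](subrK m) !z.
have sq h : u h ^+ 2 = u 1%g ^+ 2 by rewrite expr2 -{2}[h]mulg1 prod expr2.
have u1 : u 1%g != 0 by rewrite -sqrf_eq0 -(sq g0) sqrf_eq0.
pose chi g := u g / u 1%g.
have chiM g h : chi (g * h)%g = chi g * chi h.
  have E : u g * u h = u 1%g * u (g * h)%g.
    apply: (mulfI u1); rewrite mulrA [u 1%g * u g]mulrC -mulrA -(prod g h).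
    by rewrite !mulrA -!expr2 sq.
  by rewrite /chi -[u (g * h)%g](mulKf u1) -E; field.
have chi1 : chi 1%g = 1 by rewrite /chi divff.
have chi0 : \sum_g chi g = 0 by rewrite -mulr_suml ku.1 mul0r.
have Tchi g : T chi g = 0.
  rewrite -(mul0r (u 1%g)^-1) -(ku.2 g) /T mulr_suml; apply: eq_bigr => h _.
  by rewrite /chi; ring.
apply: (@real_character_nonvanishing (ext chi) _ _ _ (2 * nrm chi) (bnd chi)).
- move=> m n; have [hm|hm] := boolP (coprime d m); last first.
    by rewrite /ext coprimeMr (negbTE hm) mul0r.
  by rewrite ext_mul // /ext hm; case: ifP; rewrite ?mulr0.
- by rewrite /ext coprimen1 unit_class1.
- move=> n; rewrite /ext !inE; case: ifP => _; last by rewrite eqxx.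
  by rewrite -sqrf_eq1 /chi expr_div_n sq divff ?eqxx ?orbT // sqrf_eq0.
- move=> i j; have := @ext_bound chi 1 i j chi0.
  by under eq_bigr do rewrite mul1n.
move=> M M0; have := @T_approx chi 1 M chi0 M0.
have -> : ext (T chi) 1 = 0 by rewrite /ext Tchi if_same.
rewrite sub0r normrN.
by under eq_bigr do rewrite mul1n.
Qed.

Let T_surjective (w : G -> R) : \sum_g w g = 0 ->
  exists u, \sum_g u g = 0 /\ forall g, T u g = w g.
Proof.
move=> w0.
(* Adding the sum functional makes T an injective endomorphism of all of R^G. *)
pose A : 'M[R]_#|{: G}| :=
  \matrix_(i, j) (c ((enum_val j)^-1 * enum_val i)%g + 1).
pose fn (r : 'rV[R]_#|{: G}|) (g : G) := r 0 (enum_rank g).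
have mulA r g : (r *m A) 0 (enum_rank g) = T (fn r) g + \sum_h fn r h.
  rewrite mxE (reindex_onto (@enum_rank G) (@enum_val G predT)) /=; last first.
    by move=> i _; rewrite enum_valK.
  rewrite (eq_bigl predT) => [|h]; last by rewrite enum_rankK eqxx.
  rewrite -(sum_translate _ g) -(sum_translate (fn r) g) /T -big_split /=.
  apply: eq_bigr => h _.
  by rewrite mxE !enum_rankK mulKg mulrDr mulr1.
(* Summing over G separates the two parts of A: once the [c h] are known to add up to 0, [T u] has
   sum 0 and only #|G| times the sum of u survives. *)
have Tsum u : \sum_g T u g = (\sum_g u g) * \sum_h c h.
  rewrite /T exchange_big /= mulr_sumr; apply: eq_bigr => h _.
  rewrite -mulr_suml; congr (_ * _); rewrite -(sum_translate u h).
  by apply: eq_bigr => g _; rewrite Zp_unit_mulC.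
(* The functions [e h] add up to 0, hence so do the truncated series; the truncation error is below
   any eps for large N. *)
have sc : \sum_h c h = 0.
  apply/eqP; rewrite -normr_le0; apply/ler_addgt0Pl => eps eps0.
  pose K := \sum_h 2 * nrm (e h).
  have K0 : 0 <= K by apply: sumr_ge0 => h _; rewrite mulr_ge0.
  pose N := (Num.truncn (K / eps)).+1.
  have h1 : \sum_h \sum_(1 <= m < N.+1) ext (e h) m / m%:R = 0.
    rewrite exchange_big /= big1 // => m _; rewrite -mulr_suml -ext_sum.
    rewrite /ext; case: ifP => _; last by rewrite mul0r.
    rewrite /e sumrB; under eq_bigr do rewrite -[delta _ _]mul1r.
    rewrite (sum_delta (fun=> 1)) sumr_const -[X in _ - X]mulr_natr mulVf ?gt_eqF //.
    by rewrite subrr mul0r.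
  rewrite addr0.
  have -> : \sum_h c h = \sum_h (c h - \sum_(1 <= m < N.+1) ext (e h) m / m%:R).
    by rewrite sumrB h1 subr0.
  apply: le_trans (ler_norm_sum _ _ _) _.
  apply: le_trans (_ : K / N%:R <= _).
    by rewrite /K mulr_suml; apply: ler_sum => h _; apply: hc.
  rewrite ler_pdivrMr ?ltr0n // mulrC -ler_pdivrMr // ltW //.
  exact: truncnS_gt.
have inj (r : 'rV[R]_#|{: G}|) : r *m A = 0 -> r = 0.
  move=> rA; have E g : T (fn r) g + \sum_h fn r h = 0 by rewrite -mulA rA mxE.
  have s0 : \sum_h fn r h = 0.
    have : \sum_g (T (fn r) g + \sum_h fn r h) = 0 by rewrite big1.
    rewrite big_split /= Tsum sc mulr0 add0r sumr_const => /eqP.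
    by rewrite -mulr_natr mulf_eq0 orbC gt_eqF //= => /eqP.
  have kr : kerT (fn r) by split=> // g; have := E g; rewrite s0 addr0.
  apply/rowP => i; rewrite mxE -(kerT_zero (enum_val i) kr) /fn enum_valK.
  by [].
have uA : A \in unitmx.
  rewrite -row_free_unit -kermx_eq0; apply/eqP/row_matrixP => i; rewrite row0.
  by apply: inj; rewrite -row_mul mulmx_ker row0.
pose r := (\row_i w (enum_val i)) *m invmx A.
have E g : T (fn r) g + \sum_h fn r h = w g.
  by rewrite -mulA /r mulmxKV // mxE enum_rankK.
have s0 : \sum_h fn r h = 0.
  have : \sum_g (T (fn r) g + \sum_h fn r h) = 0.
    by rewrite (eq_bigr w) // => g _; apply: E.
  rewrite big_split /= Tsum sc mulr0 add0r sumr_const => /eqP.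
  by rewrite -mulr_natr mulf_eq0 orbC gt_eqF //= => /eqP.
by exists (fn r); split=> // g; rewrite -E s0 addr0.
Qed.

(** Solving T u = [e h] shows that the indicator of h minus the constant 1/#|G| has density 0, and
    the constant 1 has density 1. *)
Lemma dens_class_with (h : G) : dens (ext (fun g => (g == h)%:R)) #|{: G}|%:R^-1.
Proof.
have [u [u0 Tu]] := T_surjective (sum_e h).
have h1 := dens_T u0.
have := densD h1 (densZ #|{: G}|%:R^-1 ext_one); rewrite add0r mulr1.
apply: dens_ext => n; rewrite /ext; case: ifP => _; last by rewrite mulr0 addr0.
by rewrite Tu /e /delta mulr1 subrK.
Qed.
End WithL.

Lemma dens_class (h : G) : dens (ext (fun g => (g == h)%:R)) #|{: G}|%:R^-1.
Proof. by have [c hc] := L_exists; apply: dens_class_with hc h. Qed.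
End Dirichlet.

(** Otherwise the class would carry only primes up to B and proper prime powers, of bounded total
    weight, against a positive multiple of log N. *)
Lemma dirichlet (d a B : nat) : (1 < d)%N -> coprime d a ->
  exists q, [/\ prime q, (B < q)%N & q = a %[mod d]].
Proof.
case: d => [|[|k]] // _ cop; apply: contrapT => hn.
have hq q : prime q -> q = a %[mod k.+2] -> (q <= B)%N.
  by move=> pq qa; rewrite leqNgt; apply/negP => Bq; apply: hn; exists q.
have [C hC] := dens_class (unit_class k a).
have [C' hC'] := mangoldt_nonprime_bound.
pose I : R := #|{: {unit 'Z_(k.+2)}}|%:R^-1; rewrite -/I in hC.
have I0 : 0 < I by rewrite invr_gt0 ltr0n; apply/card_gt0P; exists 1%g.
pose S := \sum_(1 <= n < B.+1) mangoldt n / n%:R.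
have t0 n : 0 <= mangoldt n / n%:R by rewrite divr_ge0 ?mangoldt_ge0.
have [N N0] := ln_unbounded ((C + C' + S) / I).
rewrite ltr_pdivrMr //; apply/negP; rewrite -leNgt.
have := hC N N0; rewrite ler_norml => /andP[+ _].
set X := \sum_(_ <= _ < _) _ => h.
suff : X <= S + C' by rewrite mulrC; lra.
apply: le_trans (lerD (lexx _) (hC' N)).
rewrite /X (bigID prime) /=; apply: lerD; last first.
  apply: ler_sum => n _; rewrite ler_piMr //.
  by rewrite /ext; case: ifP => // _; case: eqP => // _; rewrite ler01.
apply: le_trans (_ : \sum_(1 <= n < N.+1 | (n < B.+1)%N) mangoldt n / n%:R <= _).
  rewrite big_mkcond [leRHS]big_mkcond /=; apply: ler_sum => n _.
  case: ifP => [pn|_]; last by case: ifP.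
  rewrite /ext; case: ifP => [cn|_]; last by rewrite mulr0; case: ifP.
  case: eqP => [E|_]; last by rewrite mulr0; case: ifP.
  rewrite mulr1 ifT // ltnS; apply: hq => //.
  have := congr1 val E; rewrite !val_unit_class // => /(congr1 val) /=.
  by rewrite !val_Zp_nat.
apply: le_trans (@sum_nat_mono _ _ 1 N.+1 (N + B).+1 _ _) _ => //.
  by rewrite ltnS leq_addr.
by rewrite /S [leRHS](@big_nat_widen _ _ _ 1 B.+1 (N + B).+1) ?ltnS ?leq_addl.
Qed.

(** * Christol's inequalities *)

Definition cnt (q : nat) (s t : int) (lo hi : nat) : nat :=
  (\sum_(lo <= i < hi) (q%:Z %| (s * i%:Z + t)%R)%Z)%N.

Lemma cnt_period (q : nat) (s t : int) (lo : nat) : (0 < q)%N -> coprimez s q ->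
  cnt q s t lo (lo + q) = 1%N.
Proof.
move=> q0 /coprimezP [[y z] /= yz].
(* By the Bezout relation y inverts s modulo q, so the solution is the residue of - t y; it is
   shifted into the window starting at [lo]. *)
pose X : int := - (t * y) - lo%:Z.
have r0 : (0 <= X %% q%:Z)%Z by rewrite modz_ge0 // eqz_nat -lt0n.
have rq : ((X %% q%:Z)%Z < q%:Z)%R by rewrite ltz_pmod.
pose i0 := (lo + `|(X %% q%:Z)%Z|)%N.
have i0E : i0%:Z = lo%:Z + (X %% q%:Z)%Z by rewrite /i0 PoszD gez0_abs.
have d0 : (q%:Z %| s * i0%:Z + t)%Z.
  apply/dvdzP; exists (t * z - s * (X %/ q%:Z)%Z).
  have -> : s * i0%:Z + t = s * (X - (X %/ q%:Z)%Z * q%:Z + lo%:Z) + t.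
    by rewrite i0E {2}(divz_eq X q%:Z); ring.
  move: (X %/ q%:Z)%Z => m; rewrite /X.
  have -> : s * (- (t * y) - lo%:Z - m * q%:Z + lo%:Z) + t
    = t * (y * s + z * q%:Z) - t * y * s - s * m * q%:Z by rewrite yz; ring.
  by ring.
have i0in : i0 \in index_iota lo (lo + q).
  by rewrite mem_index_iota leq_addr /= ltn_add2l -ltz_nat gez0_abs.
rewrite /cnt (bigD1_seq i0) ?iota_uniq //= d0 big_seq_cond big1 // => i.
rewrite mem_index_iota => /andP[/andP[lo_i i_hi] ii0].
case: (boolP (_ %| _)%Z) => // di; exfalso.
have : (q%:Z %| s * (i%:Z - i0%:Z))%Z.
  have -> : s * (i%:Z - i0%:Z) = (s * i%:Z + t) - (s * i0%:Z + t) by ring.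
  by rewrite rpredB.
rewrite Gauss_dvdzr; last by rewrite coprimez_sym; apply/coprimezP; exists (y, z).
move=> /dvdzP[k kE].
move: i0in; rewrite mem_index_iota => /andP[h1 h2].
have k0 : k = 0 by nia.
by move: kE ii0; rewrite k0 mul0r => /eqP; rewrite subr_eq0 eqz_nat => ->.
Qed.

Lemma cnt_cat (q : nat) (s t : int) (a b c : nat) : (a <= b)%N -> (b <= c)%N ->
  cnt q s t a c = (cnt q s t a b + cnt q s t b c)%N.
Proof. by move=> ab bc; rewrite /cnt (@big_cat_nat _ _ _ b). Qed.

Lemma cnt_block (q : nat) (s t : int) (lo m : nat) : (0 < q)%N -> coprimez s q ->
  cnt q s t lo (lo + m * q) = m.
Proof.
move=> q0 cop; elim: m => [|m IH]; first by rewrite mul0n addn0 /cnt big_geq.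
rewrite (@cnt_cat _ _ _ _ (lo + m * q)) ?leq_addr ?leq_add2l ?leq_mul2r ?leqnSn ?orbT //.
rewrite IH; have -> : (lo + m.+1 * q = lo + m * q + q)%N by rewrite mulSn; lia.
by rewrite cnt_period // addn1.
Qed.

Lemma cnt_add (q : nat) (s t : int) (Z m : nat) : (0 < q)%N -> coprimez s q ->
  cnt q s t 1 (Z + m * q).+1 = (cnt q s t 1 Z.+1 + m)%N.
Proof.
move=> q0 cop; rewrite (@cnt_cat _ _ _ _ Z.+1) // ?ltnS ?leq_addr //.
by rewrite -addSn cnt_block.
Qed.

(* Both sides count the m in [1, dn] with Q | m and m = u mod d. *)
Lemma cnt_cross (Q d u n : nat) : (0 < Q)%N -> (0 < u <= d)%N ->
  cnt Q d u 0 n = cnt d Q (- u%:Z) 1 (d * n %/ Q).+1.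
Proof.
move=> Q0 /andP[u0 ud].
have -> : cnt d Q (- u%:Z) 1 (d * n %/ Q).+1 =
  (\sum_(1 <= m < (d * n).+1 | (Q %| m)%N) (d%:Z %| (m%:Z - u%:Z)%R)%Z)%N.
  by rewrite sum_multiples //; apply: eq_bigr => j _; rewrite PoszM.
rewrite /cnt; elim: n => [|n IH]; first by rewrite muln0 !big_geq.
rewrite big_nat_recr //= IH.
rewrite [RHS](@big_cat_nat _ _ _ (d * n).+1) //=; last by rewrite ltnS leq_mul2l leqnSn orbT.
congr (_ + _)%N; rewrite big_mkcond /= (bigD1_seq (d * n + u)%N) ?iota_uniq //=; last first.
  by rewrite mem_index_iota mulnS; lia.
rewrite big_seq_cond big1 ?addn0.
  have -> : (d%:Z %| (d * n + u)%:Z - u%:Z)%Z.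
    by rewrite PoszD addrK PoszM dvdz_mulr ?dvdzz.
  have -> : d%:Z * n%:Z + u%:Z = (d * n + u)%:Z by rewrite PoszD PoszM.
  by rewrite dvdzE !absz_nat; case: (Q %| _)%N.
move=> m; rewrite mem_index_iota mulnS => /andP[/andP[h1 h2] h3].
case: ifP => // _; case: (boolP (_ %| _)%Z) => // /dvdzP [k kE]; exfalso.
have k_n : k = n%:Z.
  have : k%R < n%:Z + 1 by nia.
  have : n%:Z - 1 < k by nia.
  lia.
by move/eqP: h3; apply; apply/eqP; rewrite -eqz_nat PoszD PoszM -[m%:Z](subrK u%:Z) kE k_n mulrC.
Qed.

Lemma logn_sum (p L m : nat) : prime p -> (0 < m)%N -> (logn p m <= L)%N ->
  logn p m = (\sum_(1 <= l < L.+1) (p ^ l %| m))%N.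
Proof.
move=> pp m0 mL; under eq_bigr => l _ do rewrite pfactor_dvdn //.
have h K : (\sum_(1 <= l < K.+1) (l <= logn p m))%N = minn K (logn p m).
  elim: K => [|K IH]; first by rewrite big_geq // min0n.
  rewrite big_nat_recr //= IH; lia.
by rewrite h; apply/esym/minn_idPr.
Qed.

(** For x = u/d with no factor x + k equal to 0, this is the valuation of d^n (x)_n, as a natural
    number. *)
Definition lognprod (p d : nat) (u : int) (n : nat) : nat :=
  (\sum_(0 <= k < n) logn p `|(d%:Z * k%:Z + u)%R|)%N.

Lemma lognprod_cnt (p L d : nat) (u : int) (n : nat) : prime p ->
  (forall k, (k < n)%N -> d%:Z * k%:Z + u != 0) ->
  (forall k, (k < n)%N -> (logn p `|(d%:Z * k%:Z + u)%R| <= L)%N) ->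
  lognprod p d u n = (\sum_(1 <= l < L.+1) cnt (p ^ l) d u 0 n)%N.
Proof.
move=> pp nz hL; rewrite /lognprod /cnt exchange_big_nat /=.
apply: eq_big_nat => k /andP[_ kn].
rewrite (@logn_sum p L) ?absz_gt0 ?nz ?hL //.
Qed.

Lemma logn_lt_self (p m L : nat) : (0 < m)%N -> (m <= L)%N -> (logn p m <= L)%N.
Proof. by move=> m0; apply: leq_trans; apply/ltnW/ltn_logl. Qed.

Lemma dvdz_mod_congr (d q a w : nat) (t : int) : q = a %[mod d] ->
  (d%:Z %| q%:Z * w%:Z + t)%Z = (d%:Z %| a%:Z * w%:Z + t)%Z.
Proof.
move=> E; have dqa : (d%:Z %| q%:Z - a%:Z)%Z.
  by rewrite -eqz_mod_dvd; apply/eqP; rewrite !modz_nat E.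
have -> : q%:Z * w%:Z + t = (q%:Z - a%:Z) * w%:Z + (a%:Z * w%:Z + t) by ring.
by rewrite rpredDl ?dvdz_mulr ?dvdzz.
Qed.

Section Christol.
Variables (d : nat) (us vs : seq nat).
Hypothesis d1 : (1 < d)%N.
Hypothesis us_range : forall u, u \in us -> (0 < u <= d)%N.
Hypothesis vs_range : forall v, v \in vs -> (0 < v <= d)%N.
Hypothesis large_primes : exists Q0 : nat, forall q n, prime q -> (Q0 < q)%N ->
  (\sum_(v <- vs) lognprod q d v n <= \sum_(u <- us) lognprod q d u n)%N.

(* Apply the hypothesis to a large prime q = a mod d and n = ceil(q R / P). *)
Lemma christol (a P R : nat) : coprime d a -> (R < P)%N ->
  (\sum_(v <- vs) cnt d a (- v%:Z) 1 (d * R %/ P).+1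
   <= \sum_(u <- us) cnt d a (- u%:Z) 1 (d * R %/ P).+1)%N.
Proof.
move=> cop RP; have [Q0 hQ] := large_primes.
(* q > d P leaves no room for an integer between the two quotients in [ZE], and also gives q > d; q
   > Q0 makes [large_primes] applicable. *)
have [q [pq Bq qa]] := @dirichlet d a (Q0 + d * P + P) d1 cop.
have q0 := prime_gt0 pq.
have P0 : (0 < P)%N by apply: leq_ltn_trans RP.
pose n := ((q * R + P.-1) %/ P)%N.
have n_ge : (q * R <= n * P)%N.
  have := ltn_ceil (q * R + P.-1)%N P0; rewrite -/n mulSn; lia.
have n_le : (n * P < q * R + P)%N.
  have := leq_divM (q * R + P.-1)%N P; rewrite -/n; lia.
have nq : (n <= q)%N.
  rewrite leqNgt; apply/negP => qn.
  have h1 : (q.+1 * P <= n * P)%N by rewrite leq_mul2r qn orbT.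
  have h2 : (q * R <= q * P.-1)%N by rewrite leq_mul2l; apply/orP; right; lia.
  have h3 : (q * P = q * P.-1 + q)%N by rewrite -{1}(prednK P0) mulnS addnC.
  rewrite mulSn in h1; lia.
(* d n / q lies between d R / P and d R / P + d / q, and d / q < 1 / P while d R / P is a multiple
   of 1 / P: no integer is crossed. *)
have ZE : (d * n %/ q = d * R %/ P)%N.
  pose Z := (d * R %/ P)%N.
  have z1 : (Z * P <= d * R)%N := leq_divM _ _.
  have z2 : (d * R < Z.+1 * P)%N := ltn_ceil _ P0.
  apply/eqP; rewrite eqn_leq -/Z; apply/andP; split.
    rewrite -ltnS ltn_divLR // -(ltn_pmul2r P0).
    have e1 : (d * n * P < d * (q * R + P))%N by rewrite -mulnA ltn_pmul2l // ltnW.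
    have e2 : (q * (d * R).+1 <= q * (Z.+1 * P))%N by rewrite leq_mul2l z2 orbT.
    apply: leq_trans e1 _; rewrite mulnAC [(_ * q)%N]mulnC; apply: leq_trans e2.
    by rewrite mulnDr mulnS mulnCA addnC leq_add2r; lia.
  rewrite leq_divRL // -(leq_pmul2r P0) mulnAC.
  apply: (@leq_trans (d * R * q)); first by rewrite leq_mul2r z1 orbT.
  by rewrite -mulnA -[(d * n * P)%N]mulnA leq_mul2l [(R * q)%N]mulnC n_ge orbT.
have key u : (0 < u <= d)%N ->
  lognprod q d u n = cnt d a (- u%:Z) 1 (d * R %/ P).+1.
  (* All factors d k + u are below q^2, so the first power of q is the only one to count. *)
  move=> /andP[u0 ud]; rewrite (@lognprod_cnt q 1) //.
  - rewrite big_nat1 expn1 cnt_cross ?u0 // ZE /cnt; apply: eq_bigr => w _.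
    by rewrite (dvdz_mod_congr _ _ qa).
  - by move=> k kn; rewrite gt_eqF // ltr_wpDl // -?PoszM.
  move=> k kn; have -> : `|(d%:Z * k%:Z + u%:Z)%R|%N = (d * k + u)%N by rewrite -PoszM -PoszD.
  have m0 : (0 < d * k + u)%N by rewrite addn_gt0 u0 orbT.
  have mlt : (d * k + u < q * q)%N.
    have h1 : (d * k + u <= d * n)%N.
      apply: (@leq_trans (d * k.+1)); last by rewrite leq_mul2l kn orbT.
      by rewrite mulnS addnC leq_add2r.
    apply: leq_ltn_trans h1 _; apply: (@leq_ltn_trans (d * q)); first by rewrite leq_mul2l nq orbT.
    rewrite ltn_pmul2r //; apply: leq_ltn_trans Bq.
    apply: (@leq_trans (d * P)); first by rewrite leq_pmulr.
    by rewrite -addnA addnCA leq_addr.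
  rewrite leqNgt; apply/negP => h.
  have dv : (q ^ 2 %| d * k + u)%N by rewrite pfactor_dvdn.
  by have := leq_ltn_trans (dvdn_leq m0 dv) mlt; rewrite mulnn ltnn.
have Qq : (Q0 < q)%N by apply: leq_ltn_trans Bq; rewrite -addnA leq_addr.
have := hQ q n pq Qq.
rewrite !big_seq (eq_bigr (fun v => cnt d a (- v%:Z) 1 (d * R %/ P).+1)) => [|v vv]; last exact/key/vs_range.
rewrite [X in (_ <= X)%N -> _](eq_bigr (fun v => cnt d a (- v%:Z) 1 (d * R %/ P).+1)) // => u uu.
exact/key/us_range.
Qed.
End Christol.

(** * Averages of Christol's inequalities at a fixed prime *)

Section KeyInequality.
Variables (p e d' : nat).
Hypotheses (pp : prime p) (e0 : (0 < e)%N) (d'0 : (0 < d')%N) (cop : coprime p d').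
Let d := (p ^ e * d')%N.
Let phi := (p ^ e - p ^ e.-1)%N.
Let p0 : (0 < p)%N := prime_gt0 pp.
Let px0 k : (0 < p ^ k)%N. Proof. by rewrite expn_gt0 p0. Qed.
Let d0 : (0 < d)%N. Proof. by rewrite muln_gt0 px0. Qed.
Let cop_pow k : coprimez (p ^ k)%N%:Z d'%:Z.
Proof. by rewrite coprimezE !absz_nat coprimeXl. Qed.

Let phiE : (phi + p ^ e.-1 = p ^ e)%N.
Proof. by rewrite subnK // leq_exp2l ?prime_gt1 // leq_pred. Qed.

Let units_count : (\sum_(0 <= j < p ^ e | ~~ (p %| j)) 1 = phi)%N.
Proof.
apply/eqP; rewrite -(eqn_add2r (p ^ e.-1)) phiE.
have h : cnt p 1 0 0 (p ^ e) = (p ^ e.-1)%N.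
  by have := @cnt_block p 1 0 0 (p ^ e.-1) p0 (coprime1n p); rewrite add0n -expnSr prednK.
rewrite -h /cnt; under [X in (_ + X)%N]eq_bigr => i _ do rewrite mul1r addr0.
have -> : (\sum_(0 <= i < p ^ e) (p%:Z %| i%:Z)%Z = \sum_(0 <= j < p ^ e | p %| j) 1)%N.
  by rewrite [RHS]big_mkcond; apply: eq_bigr => i _; rewrite dvdzE !absz_nat; case: (p %| i)%N.
have E : (\sum_(0 <= j < p ^ e) 1 = \sum_(0 <= j < p ^ e | p %| j) 1
    + \sum_(0 <= j < p ^ e | ~~ (p %| j)) 1)%N by rewrite (bigID (fun j => p %| j)%N).
by rewrite addnC -E sum_nat_const_nat subn0 muln1.
Qed.

(** For l > 0, p^l + d' j runs once through the classes modulo d that are prime to p and agree with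
    p^l modulo d'. *)
Let M (l u R : nat) : nat :=
  (\sum_(0 <= j < p ^ e | ~~ (p %| j)) cnt d (p ^ l + d' * j)%N (- u%:Z) 1 (d * R %/ p ^ l).+1)%N.

(** With a = p^l + d' j, this counts the j for which p^e divides a w - u. The condition modulo d'
    does not involve j and factors out in [M_swap]. *)
Let J (l u w : nat) : nat :=
  (\sum_(0 <= j < p ^ e | ~~ (p %| j))
     ((p ^ e)%N%:Z %| ((d'%:Z * w%:Z) * j%:Z + ((p ^ l)%N%:Z * w%:Z - u%:Z))%R)%Z)%N.

Let M_swap (l u R : nat) : M l u R =
  (\sum_(1 <= w < (d * R %/ p ^ l).+1)
     (d'%:Z %| ((p ^ l)%N%:Z * w%:Z - u%:Z)%R)%Z * J l u w)%N.
Proof.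
rewrite /M /cnt exchange_big /=; apply: eq_bigr => w _.
rewrite /J big_distrr /=; apply: eq_bigr => j _.
rewrite mulnb -[d%:Z]/((p ^ e * d')%N%:Z) PoszM (Gauss_dvdz _ (cop_pow e)) andbC PoszD PoszM.
congr (nat_of_bool (_ && _)); last by congr (_ %| _)%Z; ring.
have -> : ((p ^ l)%N%:Z + d'%:Z * j%:Z) * w%:Z + - u%:Z
   = d'%:Z * (j%:Z * w%:Z) + ((p ^ l)%N%:Z * w%:Z - u%:Z) by ring.
by rewrite rpredDl // dvdz_mulr ?dvdzz.
Qed.

Let p_dvd_pow l : (0 < l)%N -> (p %| p ^ l)%N.
Proof. by case: l => // l _; rewrite expnS dvdn_mulr. Qed.

Let p_ndvd_a l j : (0 < l)%N -> ~~ (p %| j)%N -> coprime p (p ^ l + d' * j).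
Proof.
move=> l0 pj; rewrite prime_coprime // dvdn_addr ?p_dvd_pow // Euclid_dvdM // negb_or pj andbT.
by rewrite -prime_coprime.
Qed.

Let J_argE l u w j : (d'%:Z * w%:Z) * j%:Z + ((p ^ l)%N%:Z * w%:Z - u%:Z)
  = (p ^ l + d' * j)%N%:Z * w%:Z - u%:Z.
Proof. by rewrite PoszD PoszM; ring. Qed.

Let J_Zp (l u1 w : nat) : (0 < l)%N ->
  J l (p ^ e * u1) w = if (p ^ e %| w)%N then phi else 0%N.
Proof.
move=> l0; rewrite -units_count.
have E j : ~~ (p %| j)%N ->
  ((p ^ e)%N%:Z %| (d'%:Z * w%:Z) * j%:Z + ((p ^ l)%N%:Z * w%:Z - (p ^ e * u1)%N%:Z))%Z = (p ^ e %| w)%N.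
  move=> pj; rewrite J_argE rpredBr; last by rewrite dvdzE !absz_nat dvdn_mulr.
  by rewrite -PoszM dvdzE !absz_nat Gauss_dvdr // coprimeXl // p_ndvd_a.
rewrite /J; under eq_bigr => j pj do rewrite E //.
by case: ifP => // _; rewrite big1.
Qed.

(** As a is prime to p, a w = u modulo p^e forces w to have valuation g. Dividing by p^g then leaves
    one class of j modulo p^(e-g), automatically prime to p because u1 is, and met p^g times below
    p^e. *)
Let J_nonZp (l g u1 w : nat) : (0 < l)%N -> (g < e)%N -> ~~ (p %| u1)%N ->
  J l (p ^ g * u1) w = if (p ^ g %| w)%N && ~~ (p ^ g.+1 %| w)%N then (p ^ g)%N else 0%N.
Proof.
move=> l0 ge pu1; pose u := (p ^ g * u1)%N.
have gE : (p ^ g %| p ^ e)%N by rewrite dvdn_exp2l // ltnW.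
have g1E : (p ^ g.+1 %| p ^ e)%N by rewrite dvdn_exp2l.
case: ifP => [/andP[/dvdnP[w1 wE] gw]|ncond].
  have pw1 : ~~ (p %| w1)%N.
    by apply: contra gw => h; rewrite wE expnS dvdn_mul.
  pose f := (e - g)%N; have f0 : (0 < f)%N by rewrite subn_gt0.
  have eE : (p ^ e = p ^ g * p ^ f)%N by rewrite -expnD subnKC // ltnW.
  have E j : ((p ^ e)%N%:Z %| (d'%:Z * w%:Z) * j%:Z + ((p ^ l)%N%:Z * w%:Z - u%:Z))%Z
     = ((p ^ f)%N%:Z %| (d' * w1)%N%:Z * j%:Z + ((p ^ l)%N%:Z * w1%:Z - u1%:Z))%Z.
    rewrite eE PoszM -(@dvdz_mul2l (p ^ g)%N%:Z (p ^ f)%N%:Z); last by rewrite eqz_nat -lt0n.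
    by congr (_ %| _)%Z; rewrite wE /u !PoszM; ring.
  rewrite /J; under eq_bigr => j _ do rewrite E.
  rewrite big_mkcond /=.
  have copf : coprimez (d' * w1)%N%:Z (p ^ f)%N%:Z.
    by rewrite coprimezE !absz_nat coprimeXr // coprime_sym coprimeMr cop prime_coprime.
  rewrite -[RHS](cnt_block ((p ^ l)%N%:Z * w1%:Z - u1%:Z) 0 (p ^ g) (px0 f) copf) add0n -eE /cnt.
  apply: eq_bigr => j _; case: ifP => // /negbFE pj.
  case: (boolP (_ %| _)%Z) => // h; exfalso; move/negP: pu1; apply.
  have : (p%:Z %| (d' * w1)%N%:Z * j%:Z + ((p ^ l)%N%:Z * w1%:Z - u1%:Z))%Z.
    by apply: dvdz_trans h; rewrite dvdzE !absz_nat p_dvd_pow.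
  rewrite rpredDl; last by rewrite dvdz_mull // dvdzE !absz_nat.
  rewrite rpredBl; last by rewrite dvdz_mulr // dvdzE !absz_nat p_dvd_pow.
  by rewrite dvdzE !absz_nat.
rewrite /J big1 // => j pj; rewrite J_argE.
case: (boolP (_ %| _)%Z) => // h; exfalso; move/negP: ncond; apply.
pose a := (p ^ l + d' * j)%N; rewrite -/a in h.
have copa k : coprime (p ^ k) a by rewrite coprimeXl // p_ndvd_a.
have hg : (p ^ g %| w)%N.
  rewrite -(Gauss_dvdr _ (copa g)) -[(_ %| _)%N]/((p ^ g)%N%:Z %| (a * w)%N%:Z)%Z PoszM.
  rewrite -[a%:Z * _](subrK (p ^ g * u1)%N%:Z) rpredDr; last by rewrite dvdzE !absz_nat dvdn_mulr.
  by apply: dvdz_trans h; rewrite dvdzE !absz_nat.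
rewrite hg /=; apply/negP => hg1.
move/negP: pu1; apply.
rewrite -(@dvdn_pmul2l (p ^ g)) // -expnSr -[(_ %| _)%N]/((p ^ g.+1)%N%:Z %| (p ^ g * u1)%N%:Z)%Z.
have hw : ((p ^ g.+1)%N%:Z %| a%:Z * w%:Z)%Z by rewrite dvdz_mull // dvdzE !absz_nat.
rewrite -[(_ * u1)%N%:Z]opprK rpredN -(rpredDl _ hw).
by apply: dvdz_trans h; rewrite dvdzE !absz_nat.
Qed.

(** The added multiple of phi restores the blocks of length p^l lost in n mod p^l. It is the same
    for every parameter, so it cancels between tuples of equal size. *)
Let M_Zp (l u1 n : nat) : (0 < l)%N -> (0 < u1 <= d')%N ->
  (M l (p ^ e * u1) (n %% p ^ l) + phi * (n %/ p ^ l)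
   = phi * cnt (p ^ l) d' u1 0 n)%N.
Proof.
move=> l0 u1r; set R := (n %% p ^ l)%N.
have -> : M l (p ^ e * u1) R = (phi * cnt (p ^ l) d' u1 0 R)%N.
  rewrite M_swap; under eq_bigr => w _ do rewrite J_Zp //.
  rewrite cnt_cross //; set Z := (d * R %/ p ^ l)%N.
  have -> : (d' * R %/ p ^ l = Z %/ p ^ e)%N.
    by rewrite /Z /d -divnMA [(p ^ l * _)%N]mulnC -mulnA divnMl.
  pose b w := nat_of_bool (d'%:Z %| (p ^ l)%N%:Z * w%:Z - (p ^ e * u1)%N%:Z)%Z.
  have -> : cnt d' (p ^ l)%N (- u1%:Z) 1 (Z %/ p ^ e).+1 = (\sum_(1 <= w < Z.+1 | p ^ e %| w) b w)%N.
    rewrite sum_multiples //; apply: eq_bigr => j _; rewrite /b.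
    have -> : (p ^ l)%N%:Z * (p ^ e * j)%N%:Z - (p ^ e * u1)%N%:Z
      = (p ^ e)%N%:Z * ((p ^ l)%N%:Z * j%:Z + - u1%:Z) by rewrite !PoszM; ring.
    by rewrite Gauss_dvdzr // coprimez_sym.
  rewrite big_distrr /= [RHS]big_mkcond /=; apply: eq_bigr => w _.
  by case: ifP; rewrite ?muln0 // mulnC.
rewrite -mulnDr; congr (_ * _)%N.
have nE : (n = R + n %/ p ^ l * p ^ l)%N by rewrite addnC -divn_eq.
rewrite {2}nE [RHS](@cnt_cat _ _ _ _ R) // ?leq_addr // cnt_block //.
by rewrite coprimez_sym.
Qed.

Let A (u t Z : nat) : nat := cnt d' (p ^ t)%N (- u%:Z) 1 Z.+1.

(* The terms c k make the sum over l telescope. *)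
Let M_nonZp (l g f u1 n : nat) : (0 < l)%N -> e = (g + f.+1)%N -> ~~ (p %| u1)%N ->
  let u := (p ^ g * u1)%N in
  let c k := A u (k + g) (p ^ f.+1 * d' * n %/ p ^ k)%N in
  (M l u (n %% p ^ l) + phi * (n %/ p ^ l) + p ^ g * c l.+1 = p ^ g * c l)%N.
Proof.
move=> l0 eE pu1 u c; set R := (n %% p ^ l)%N; set m := (n %/ p ^ l)%N.
have ge : (g < e)%N by rewrite eE addnS ltnS leq_addr.
set Z := (d * R %/ p ^ l)%N.
have step1 : (M l u R + p ^ g * A u (l.+1 + g) (Z %/ p ^ g.+1) = p ^ g * A u (l + g) (Z %/ p ^ g))%N.
  rewrite M_swap; under eq_bigr => w _ do rewrite J_nonZp //.
  pose b w := nat_of_bool (d'%:Z %| (p ^ l)%N%:Z * w%:Z - u%:Z)%Z.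
  have AE h : A u (l + h) (Z %/ p ^ h) = (\sum_(1 <= w < Z.+1 | p ^ h %| w) b w)%N.
    rewrite sum_multiples // /A /cnt; apply: eq_bigr => j _; rewrite /b.
    by congr (nat_of_bool (_ %| _)%Z); rewrite expnD !PoszM; ring.
  rewrite addSnnS !AE !big_distrr /= [X in (_ + X)%N]big_mkcond [RHS]big_mkcond -big_split /=.
  apply: eq_bigr => w _; rewrite -/(b w).
  have [h|h] := boolP (p ^ g.+1 %| w)%N; last by rewrite andbT addn0; case: ifP; rewrite ?muln0 // mulnC.
  by rewrite andbF muln0 add0n ifT // (dvdn_trans _ h) // dvdn_exp2l.
have nE : (n = m * p ^ l + R)%N by rewrite -divn_eq.
have dE : d = (p ^ g * (p ^ f.+1 * d'))%N by rewrite /d eE expnD mulnA.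
have Zg : (Z %/ p ^ g = p ^ f.+1 * d' * R %/ p ^ l)%N.
  by rewrite /Z -divnMA [(p ^ l * _)%N]mulnC dE -mulnA divnMl.
have Zg1 : (Z %/ p ^ g.+1 = p ^ f.+1 * d' * R %/ p ^ l.+1)%N.
  by rewrite expnSr divnMA Zg -divnMA -expnSr.
have cl : c l = (A u (l + g) (Z %/ p ^ g) + p ^ f.+1 * m)%N.
  rewrite /c /A -cnt_add //; congr (cnt _ _ _ _ _.+1).
  rewrite Zg {1}nE mulnDr mulnA divnMDl // addnC; congr (_ + _)%N.
  by rewrite mulnAC.
have cl1 : c l.+1 = (A u (l.+1 + g) (Z %/ p ^ g.+1) + p ^ f * m)%N.
  rewrite /c /A -cnt_add //; congr (cnt _ _ _ _ _.+1).
  have -> : (p ^ f.+1 * d' * n = p ^ f * m * d' * p ^ l.+1 + p ^ f.+1 * d' * R)%N.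
    by rewrite {1}nE !expnS; ring.
  by rewrite divnMDl // addnC Zg1.
have e1 : (p ^ g * p ^ f.+1 = p ^ e)%N by rewrite -expnD -eE.
have e2 : (p ^ g * p ^ f = p ^ e.-1)%N by rewrite -expnD eE addnS.
rewrite cl cl1 !mulnDr ![(p ^ g * (_ * m))%N]mulnA e1 e2 -step1 -phiE; ring.
Qed.

(** For x = u/d: (p - 1) times the valuation of (x)_n if x is in Z_p, and n otherwise. *)
Let weight (n u : nat) : nat :=
  if (p ^ e %| u)%N then (p.-1 * lognprod p d' (u %/ p ^ e)%N n)%N else n.

Let sum_M (u n L : nat) : (0 < u <= d)%N -> (d * n + d <= L)%N ->
  (\sum_(1 <= l < L.+1) (M l u (n %% p ^ l) + phi * (n %/ p ^ l)) = p ^ e.-1 * weight n u)%N.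
Proof.
move=> /andP[u0 ud] nL; rewrite /weight.
have phiE' : (phi = p ^ e.-1 * p.-1)%N.
  by rewrite /phi -{1}(prednK e0) expnSr -{2}[(p ^ e.-1)%N]muln1 -mulnBr subn1.
case: ifP => [/dvdnP[u1 uE]|hu].
  have u1r : (0 < u1 <= d')%N.
    move: u0 ud; rewrite uE muln_gt0 => /andP[-> _] /=.
    by rewrite /d [(p ^ e * d')%N]mulnC leq_pmul2r.
  rewrite uE mulnK // mulnA -phiE' (@lognprod_cnt p L) //; first last.
  - move=> k kn; have -> : `|(d'%:Z * k%:Z + u1%:Z)%R|%N = (d' * k + u1)%N by rewrite -PoszM -PoszD.
    have /andP[u10 u1d] := u1r.
    apply: logn_lt_self; first by rewrite addn_gt0 u10 orbT.
    apply: leq_trans nL; apply: leq_add; last by apply: leq_trans u1d _; rewrite leq_pmull.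
    by rewrite leq_mul // ?leq_pmull // ltnW.
  - by move=> k kn; have /andP[u10 _] := u1r; rewrite -PoszM -PoszD eqz_nat -lt0n addn_gt0 u10 orbT.
  rewrite big_distrr /=; apply: eq_big_nat => l /andP[l0 _].
  by rewrite [(u1 * _)%N]mulnC M_Zp.
have [u1 cu1 uE] := pfactor_coprime pp u0.
set g := logn p u in uE; have ge : (g < e)%N.
  by rewrite ltnNge; apply/negP => h; move/negP: hu; apply; rewrite pfactor_dvdn.
have pu1 : ~~ (p %| u1)%N by rewrite -prime_coprime.
pose f := (e - g).-1; have eE : e = (g + f.+1)%N by rewrite /f prednK ?subn_gt0 // subnKC // ltnW.
have uE' : u = (p ^ g * u1)%N by rewrite uE mulnC.
pose c k := A u (k + g) (p ^ f.+1 * d' * n %/ p ^ k)%N.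
have tele K : (\sum_(1 <= l < K.+1) (M l u (n %% p ^ l) + phi * (n %/ p ^ l))
    + p ^ g * c K.+1 = p ^ g * c 1)%N.
  elim: K => [|K IH]; first by rewrite big_geq.
  have h := @M_nonZp K.+1 g f u1 n isT eE pu1; rewrite -uE' /= in h.
  rewrite big_nat_recr //= -addnA; apply: etrans (congr1 (addn _) h) IH.
have cL : c L.+1 = 0%N.
  rewrite /c divn_small /A /cnt ?big_geq //.
  apply: (@leq_ltn_trans L); last by apply: ltn_trans (ltn_expl _ (prime_gt1 pp)).
  apply: leq_trans nL; apply: leq_trans (leq_addr _ _); rewrite leq_mul2r; apply/orP; right.
  by rewrite leq_mul2r leq_exp2l ?prime_gt1 // eE leq_addl orbT.
(* The range consists of exactly p^f n periods of length d', each with one solution. As [c L.+1] is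
   0, the telescoped sum is p^g p^f n = p^(e-1) n. *)
have c1 : c 1%N = (p ^ f * n)%N.
  rewrite /c /A expn1.
  have -> : (p ^ f.+1 * d' * n %/ p = 0 + p ^ f * n * d')%N.
    by rewrite expnS -!mulnA mulKn // [(d' * n)%N]mulnC.
  by rewrite cnt_add // /cnt big_geq.
by have := tele L; rewrite cL c1 muln0 addn0 mulnA -expnD eE addnS => ->.
Qed.

(* Sum Christol's inequalities over l, with P = p^l and R = n mod p^l, and over
   the a coprime to p of the form p^l + d' j with j < p^e. *)
Lemma key_inequality (us vs : seq nat) (n : nat) : size us = size vs ->
  (forall u, u \in us -> (0 < u <= d)%N) ->
  (forall v, v \in vs -> (0 < v <= d)%N) ->
  (exists Q0 : nat, forall q n, prime q -> (Q0 < q)%N ->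
    (\sum_(v <- vs) lognprod q d v n <= \sum_(u <- us) lognprod q d u n)%N) ->
  (\sum_(v <- vs) weight n v <= \sum_(u <- us) weight n u)%N.
Proof.
move=> sz hus hvs hQ.
have d1 : (1 < d)%N.
  by apply: (@leq_trans (p ^ e)); [rewrite -{1}(expn0 p) ltn_exp2l ?prime_gt1|rewrite leq_pmulr].
pose L := (d * n + d)%N.
rewrite -(leq_pmul2l (px0 e.-1)) !big_distrr /=.
pose F u := (\sum_(1 <= l < L.+1) (M l u (n %% p ^ l) + phi * (n %/ p ^ l)))%N.
rewrite !big_seq (eq_bigr F) => [|v vv]; last by rewrite /F sum_M // hvs.
rewrite [leqRHS](eq_bigr F) => [|v vv]; last by rewrite /F sum_M // hus.
rewrite -!big_seq /F exchange_big /= [leqRHS]exchange_big /=.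
rewrite big_nat_cond [leqRHS]big_nat_cond; apply: leq_sum => l /andP[/andP[l0 _] _].
rewrite !big_split /=; apply: leq_add; last first.
  by rewrite !big_const_seq !count_predT sz.
rewrite /M exchange_big /= [leqRHS]exchange_big /=; apply: leq_sum => j pj.
apply: (christol d1 hus hvs hQ); last by rewrite ltn_pmod.
rewrite /d coprimeMl coprimeXl ?p_ndvd_a //=.
by rewrite addnC mulnC /coprime gcdnMDl -/(coprime _ _) coprimeXr // coprime_sym.
Qed.
End KeyInequality.

(** * Valuations of Pochhammer symbols *)

Lemma padic_valE (p : nat) (a b : int) : a != 0 -> b != 0 ->
  padic_val p (a%:~R / b%:~R) = (logn p `|a|%N)%:Z - (logn p `|b|%N)%:Z.
Proof.
move=> a0 b0; set x : rat := a%:~R / b%:~R.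
have x0 : x != 0 by rewrite mulf_neq0 ?invr_eq0 ?intr_eq0.
have E : (numq x * b = a * denq x)%R.
  apply: (@intr_inj rat); rewrite !intrM.
  have b0' : (b%:~R : rat) != 0 by rewrite intr_eq0.
  have d0' : ((denq x)%:~R : rat) != 0 by rewrite intr_eq0 denq_neq0.
  by apply/eqP; rewrite -eqr_div // divq_num_den.
have /(congr1 absz) := E; rewrite !abszM => /(congr1 (logn p)).
rewrite !lognM ?absz_gt0 ?numq_eq0 ?denq_neq0 // => h.
by rewrite /padic_val /den; apply/eqP; rewrite subr_eq addrAC eq_sym subr_eq -!PoszD h.
Qed.

Lemma padic_val_int (p : nat) (a : int) : a != 0 ->
  padic_val p a%:~R = (logn p `|a|%N)%:Z.
Proof. by move=> a0; have := @padic_valE p a 1 a0 isT; rewrite divr1 logn1 subr0. Qed.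

Lemma padic_val_nat (p n : nat) : (0 < n)%N -> padic_val p n%:R = (logn p n)%:Z.
Proof. by move=> n0; rewrite -[n%:R]/(n%:Z%:~R) padic_val_int // eqz_nat -lt0n. Qed.

Lemma padic_valM (p : nat) (x y : rat) : x != 0 -> y != 0 ->
  padic_val p (x * y) = padic_val p x + padic_val p y.
Proof.
move=> x0 y0; rewrite -[in LHS](divq_num_den x) -[in LHS](divq_num_den y).
rewrite mulf_div -!intrM padic_valE ?mulf_neq0 ?numq_eq0 ?denq_neq0 //.
rewrite !abszM !lognM ?absz_gt0 ?numq_eq0 ?denq_neq0 //.
by rewrite /padic_val /den !PoszD; ring.
Qed.

Lemma padic_val1 (p : nat) : padic_val p 1%R = 0.
Proof. by rewrite (@padic_val_nat p 1) // logn1. Qed.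

Lemma padic_valV (p : nat) (x : rat) : x != 0 -> padic_val p x^-1 = - padic_val p x.
Proof.
move=> x0; have xV0 : x^-1 != 0 by rewrite invr_eq0.
have := padic_valM p xV0 x0; rewrite mulVf // padic_val1 => E.
by apply/eqP; rewrite -addr_eq0 -E.
Qed.

Lemma padic_val_div (p : nat) (x y : rat) : x != 0 -> y != 0 ->
  padic_val p (x / y) = padic_val p x - padic_val p y.
Proof. by move=> x0 y0; rewrite padic_valM ?invr_eq0 // padic_valV. Qed.

Lemma padic_valX (p n : nat) (x : rat) : x != 0 -> padic_val p (x ^+ n) = n%:Z * padic_val p x.
Proof.
move=> x0; elim: n => [|n IH]; first by rewrite expr0 padic_val1 mul0r.
by rewrite exprS padic_valM ?expf_neq0 // IH intS; ring.
Qed.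

Lemma padic_val_exprz (p : nat) (z : int) (x : rat) : x != 0 ->
  padic_val p (x ^ z) = z * padic_val p x.
Proof.
move=> x0; case: z => n; first exact: padic_valX.
rewrite -[x ^ Negz n]/((x ^+ n.+1)^-1) padic_valV ?expf_neq0 // padic_valX // NegzE; ring.
Qed.

Lemma padic_val_prod (I : Type) (r : seq I) (P : pred I) (F : I -> rat) (p : nat) :
  (forall i, F i != 0) ->
  padic_val p (\prod_(i <- r | P i) F i) = \sum_(i <- r | P i) padic_val p (F i).
Proof.
move=> F0; elim: r => [|i r IH]; first by rewrite !big_nil padic_val1.
rewrite !big_cons; case: ifP => // _; rewrite padic_valM ?IH //.
by elim/big_rec: _ => // j x _ x0; rewrite mulf_neq0.
Qed.

Lemma den_gt0 (x : rat) : (0 < den x)%N.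
Proof. by rewrite absz_gt0 denq_neq0. Qed.

Lemma den_denq (x : rat) : (den x)%:Z = denq x.
Proof. by rewrite gez0_abs // denq_ge0. Qed.

Lemma rat_num_den (x : rat) : x = (numq x)%:~R / (den x)%:R.
Proof. by rewrite -[(den x)%:R]/((den x)%:Z%:~R) den_denq divq_num_den. Qed.

Lemma prime_dvd_den (p : nat) (x : rat) : prime p -> (p %| den x)%N -> ~~ (p %| `|numq x|)%N.
Proof.
move=> pp pd; apply/negP => pn; have := coprime_num_den x; rewrite /coprime => /eqP E.
have : (p %| gcdn `|numq x| `|denq x|)%N by rewrite dvdn_gcd pn.
by rewrite E dvdn1 => /eqP E1; rewrite E1 in pp.
Qed.

Lemma in_ZpE (p : nat) (x : rat) : prime p -> in_Zp p x = ~~ (p %| den x)%N.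
Proof.
move=> pp; rewrite /in_Zp /padic_val; have [pd|pd] := boolP (p %| den x)%N.
  have -> : logn p `|numq x| = 0%N.
    by apply/eqP; rewrite -leqn0 leqNgt logn_gt0 mem_primes (negbTE (prime_dvd_den pp pd)) !andbF.
  have : (0 < logn p (den x))%N by rewrite logn_gt0 mem_primes pp den_gt0.
  by case: (logn p (den x)).
have -> : logn p (den x) = 0%N.
  by apply/eqP; rewrite -leqn0 leqNgt logn_gt0 mem_primes (negbTE pd) !andbF.
by rewrite subr0.
Qed.

Lemma ndvd_logn0 (p m : nat) : ~~ (p %| m)%N -> logn p m = 0%N.
Proof. by move=> h; apply/eqP; rewrite -leqn0 leqNgt logn_gt0 mem_primes (negbTE h) !andbF. Qed.

Lemma int_padic_val (x : rat) : x != 0 ->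
  (x \is a Num.int) <-> (forall p, prime p -> 0 <= padic_val p x).
Proof.
move=> x0; split=> [/intrP[z zE] p pp|h].
  by rewrite zE padic_val_int // -(intr_eq0 rat) -zE.
rewrite Qint_def -den_denq eqz_nat eqn_leq den_gt0 andbT leqNgt; apply/negP => d1.
have pp := pdiv_prime d1; have := h _ pp.
by rewrite -[0 <= _]/(in_Zp (pdiv (den x)) x) in_ZpE // pdiv_dvd.
Qed.

Lemma admissible_add_neq0 (x : rat) (k : nat) : admissible x -> x + k%:R != 0.
Proof.
move=> hx; apply: contra hx => /eqP E.
have -> : x = - k%:R by apply/eqP; rewrite -addr_eq0 E.
by rewrite rpredN natr_int oppr_le0 ler0n.
Qed.

Lemma poch_neq0 (x : rat) (n : nat) : admissible x -> poch x n != 0.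
Proof. by move=> hx; apply/prodf_neq0 => k _; apply: admissible_add_neq0. Qed.

Lemma admissible_num_neq0 (D : nat) (a : int) (x : rat) (k : nat) :
  x = a%:~R / D%:R -> (0 < D)%N -> admissible x -> D%:Z * k%:Z + a != 0.
Proof.
move=> xE D0 hx; have := admissible_add_neq0 k hx.
have D0' : (D%:R : rat) != 0 by rewrite pnatr_eq0 -lt0n.
have -> : x + k%:R = (D%:Z * k%:Z + a)%:~R / D%:R.
  by rewrite xE intrD intrM mulrDl mulrAC divff // mul1r addrC.
by rewrite mulf_eq0 negb_or intr_eq0 => /andP[].
Qed.

Lemma padic_val_poch (p D n : nat) (a : int) (x : rat) :
  x = a%:~R / D%:R -> (0 < D)%N -> admissible x ->
  padic_val p (poch x n) = (lognprod p D a n)%:Z - n%:Z * (logn p D)%:Z.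
Proof.
move=> xE D0 hx; rewrite /poch padic_val_prod; last by move=> k; apply: admissible_add_neq0.
have D0' : (D%:R : rat) != 0 by rewrite pnatr_eq0 -lt0n.
have E (k : nat) : padic_val p (x + k%:R) = (logn p `|(D%:Z * k%:Z + a)%R|%N)%:Z - (logn p D)%:Z.
  have -> : x + k%:R = (D%:Z * k%:Z + a)%:~R / (D%:Z)%:~R.
    by rewrite xE intrD intrM mulrDl mulrAC divff // mul1r addrC.
  by rewrite padic_valE ?(admissible_num_neq0 _ xE) // eqz_nat -lt0n.
under eq_bigr => k _ do rewrite E.
rewrite sumrB sumr_const card_ord -mulr_natl /lognprod big_mkord natz; congr (_ - _).
by rewrite (big_morph Posz PoszD (erefl _)).
Qed.

Lemma padic_val_poch_notin (p n : nat) (x : rat) : prime p -> admissible x -> ~~ in_Zp p x ->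
  padic_val p (poch x n) = - (n%:Z * (logn p (den x))%:Z).
Proof.
move=> pp hx; rewrite in_ZpE // negbK => pd.
rewrite (padic_val_poch p n (rat_num_den x)) ?den_gt0 // /lognprod big1 ?sub0r // => k _.
apply: ndvd_logn0; apply/negP => h; move/negP: (prime_dvd_den pp pd); apply.
have : (p%:Z %| (den x)%:Z * k%:Z + numq x)%Z by rewrite dvdzE absz_nat.
by rewrite rpredDl // dvdz_mulr // dvdzE !absz_nat.
Qed.

Lemma sum_pow_rev (p L : nat) : (0 < p)%N ->
  (p.-1 * \sum_(1 <= l < L.+1) p ^ (L - l) + 1 = p ^ L)%N.
Proof.
move=> p0; elim: L => [|L IH]; first by rewrite big_geq // muln0.
rewrite big_nat_recl // subSS subn0; under eq_bigr => l _ do rewrite subSS.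
by rewrite mulnDr -addnA IH expnS -mulSnr prednK.
Qed.

(** For l <= L exactly p^(L-l) of the k below p^L make b k + a divisible by p^l, which sums to (p^L
    - 1) / (p - 1). For l > L at most one k does, and only boundedly many such l occur since b k + a
    is O(p^L). *)
Lemma lognprod_pow (p b : nat) (a : int) : prime p -> (0 < b)%N -> ~~ (p %| b)%N ->
  (forall k : nat, b%:Z * k%:Z + a != 0) ->
  exists T : nat, forall L : nat,
    (p ^ L <= p.-1 * lognprod p b a (p ^ L) + 1 <= p ^ L + T)%N.
Proof.
move=> pp b0 pb nz; have p0 := prime_gt0 pp.
pose T := (b + `|a|)%N; exists (p.-1 * T)%N => L.
have copl l : coprimez b%:Z (p ^ l)%N%:Z.
  by rewrite coprimezE !absz_nat coprimeXr // coprime_sym prime_coprime.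
have px l : (0 < p ^ l)%N by rewrite expn_gt0 p0.
rewrite (@lognprod_cnt p (L + T) b a (p ^ L) pp) => [|k _|k kL]; first last.
- rewrite -ltnS -(ltn_exp2l _ _ (prime_gt1 pp)).
  apply: (@leq_ltn_trans `|(b%:Z * k%:Z + a)%R|).
    by apply: dvdn_leq; rewrite ?absz_gt0 // pfactor_dvdnn.
  apply: (@leq_ltn_trans (b * k + `|a|)).
    rewrite -lez_nat abszE PoszD PoszM abszE; apply: le_trans (ler_normD _ _) _.
    by rewrite lerD2r ger0_norm // -PoszM.
  apply: (@leq_ltn_trans (p ^ L * T)).
    rewrite mulnDr [(b * k)%N]mulnC; apply: leq_add; first by rewrite leq_mul2r (ltnW kL) orbT.
    by rewrite leq_pmull.
  by rewrite -addnS expnD ltn_pmul2l //; apply: ltn_trans (ltnSn _) (ltn_expl _ (prime_gt1 pp)).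
- exact: nz.
rewrite (@big_cat_nat _ _ _ L.+1) //=; last by rewrite ltnS leq_addr.
have -> : (\sum_(1 <= l < L.+1) cnt (p ^ l) b a 0 (p ^ L) = \sum_(1 <= l < L.+1) p ^ (L - l))%N.
  apply: eq_big_nat => l /andP[_ lL].
  have {1}-> : (p ^ L = 0 + p ^ (L - l) * p ^ l)%N by rewrite -expnD subnK.
  by rewrite cnt_block.
rewrite mulnDr addnAC sum_pow_rev // leq_addr /= leq_add2l leq_mul2l; apply/orP; right.
apply: (@leq_trans (\sum_(L.+1 <= l < (L + T).+1) 1)); last first.
  by rewrite sum_nat_const_nat muln1 subSS addKn.
rewrite big_nat_cond [leqRHS]big_nat_cond; apply: leq_sum => l /andP[/andP[lL _] _].
have Ll : (p ^ L <= p ^ l)%N by rewrite leq_exp2l ?prime_gt1 // ltnW.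
have := cnt_block a 0 1 (px l) (copl l).
by rewrite add0n mul1n (@cnt_cat _ _ _ 0 (p ^ L)) // => <-; rewrite leq_addr.
Qed.

(** One slope covers both cases: for x in Z_p the logarithm of the denominator drops out, for x
    outside the indicator does and the error is 0. The factor p - 1 keeps everything integral. *)
Lemma padic_val_poch_pow (p : nat) (x : rat) : prime p -> admissible x ->
  exists T : int, forall L : nat,
    `|p.-1%:Z * padic_val p (poch x (p ^ L))
      - ((in_Zp p x)%:Z - p.-1%:Z * (logn p (den x))%:Z) * (p ^ L)%N%:Z| <= T.
Proof.
move=> pp hx; have [hZ|hZ] := boolP (in_Zp p x); last first.
  exists 0 => L; rewrite (padic_val_poch_notin _ pp hx hZ) normr_le0.
  by apply/eqP; rewrite sub0r; ring.
have pd : ~~ (p %| den x)%N by rewrite -in_ZpE.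
have nz k := admissible_num_neq0 k (rat_num_den x) (den_gt0 x) hx.
have [T hT] := lognprod_pow pp (den_gt0 x) pd nz.
exists (T%:Z + 1) => L; rewrite (padic_val_poch p _ (rat_num_den x)) ?den_gt0 //.
rewrite (ndvd_logn0 pd) !mulr0 !subr0 mul1r -PoszM.
have /andP[] := hT L; set A := (p.-1 * _)%N; set B := (p ^ L)%N; rewrite ler_norml; lia.
Qed.

Lemma padic_val_prod_poch_pow (p : nat) (s : seq rat) : prime p -> all admissible s ->
  exists T : int, forall L : nat,
    `|p.-1%:Z * padic_val p (\prod_(x <- s) poch x (p ^ L))
      - ((count (in_Zp p) s)%:Z
         - p.-1%:Z * padic_val p (\prod_(x <- s) (den x)%:R)) * (p ^ L)%N%:Z| <= T.
Proof.
move=> pp; elim: s => [|x s IH] /=.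
  exists 0 => L; rewrite !big_nil padic_val1.
  by rewrite !mulr0 !subr0 ?sub0r ?oppr0 ?mul0r ?normr0.
move=> /andP[hx hs]; have [T1 h1] := IH hs; have [T2 h2] := padic_val_poch_pow pp hx.
exists (T2 + T1) => L; apply: le_trans (lerD (h2 L) (h1 L)).
apply: le_trans (ler_normD _ _); rewrite !big_cons.
rewrite padic_valM ?poch_neq0 //; last first.
  by rewrite big_seq; elim/big_rec: _ => // j y js y0; rewrite mulf_neq0 ?poch_neq0 ?(allP hs).
have d0 y : ((den y)%:R : rat) != 0 by rewrite pnatr_eq0 -lt0n den_gt0.
rewrite padic_valM // ?padic_val_nat ?den_gt0 //; last first.
  by elim/big_rec: _ => // j y _ y0; rewrite mulf_neq0.
rewrite le_eqVlt; apply/orP; left; apply/eqP; congr (`|_|); rewrite PoszD; ring.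
Qed.

(** * The Eisenstein constant *)

Lemma int_of_coprime_multiples (y : rat) (a b : int) : coprimez a b ->
  y * a%:~R \is a Num.int -> y * b%:~R \is a Num.int -> y \is a Num.int.
Proof.
move=> /coprimezP [[u v] /= uv] ha hb.
have -> : y = u%:~R * (y * a%:~R) + v%:~R * (y * b%:~R).
  have E : u%:~R * a%:~R + v%:~R * b%:~R = 1 :> rat by rewrite -!intrM -intrD uv.
  by rewrite -[LHS]mulr1 -[X in _ * X = _]E; ring.
by rewrite rpredD // rpredM // intr_int.
Qed.

(** As c f(1) is an integer for every admissible c, a positive admissible C minimising |C f(1)|
    exists; it generates because a gcd of two admissible values is again admissible. *)
Lemma eisenstein_generator (f : nat -> rat) : f 0%N = 1 -> f 1%N != 0 -> N_integral f ->
  exists2 C : rat, 0 < C &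
    forall c, integral_series (rescale c f) <-> exists k : int, c = C * k%:~R.
Proof.
move=> f0 f1 [c0 c0n0 hc0].
pose S c := integral_series (rescale c f).
have SM c (k : int) : S c -> S (c * k%:~R).
  by move=> hc n; rewrite /rescale exprMn mulrA -rmorphXn rpredM ?intr_int //; apply: hc.
pose P m := `[< (0 < m)%N /\ exists2 c, 0 < c & S c /\ `|c * f 1%N| = m%:R >].
have S_norm c : S c -> c != 0 -> exists2 m, P m & `|c * f 1%N| = m%:R.
  move=> hc cn0; have /intrP[z zE] := hc 1%N.
  have zE' : c * f 1%N = z%:~R by rewrite -zE /rescale expr1 mulrC.
  exists `|z|%N.
    apply/asboolP; split.
      by rewrite absz_gt0 -(intr_eq0 rat) -zE' mulf_neq0.
    exists `|c|; first by rewrite normr_gt0.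
    split; last by rewrite normrM normr_id -normrM zE' -intr_norm -abszE.
    have [cp|cp] := lerP 0 c; [by rewrite ger0_norm|rewrite ltr0_norm //].
    by have := SM c (-1) hc; rewrite mulrN1z mulrN mulr1.
  by rewrite zE' -intr_norm -abszE.
have exP : exists m, P m by have [m hm _] := S_norm _ hc0 c0n0; exists m.
case: (ex_minnP exP) => m /asboolP[m0 [C C0 [SC Cm]]] mmin.
exists C => // c; split=> [hc|[k ->]]; last exact: SM.
have [->|cn0] := eqVneq c 0; first by exists 0; rewrite mulr0.
have /intrP[k kE] := hc 1%N; have /intrP[z zE] := SC 1%N.
have {}kE : c * f 1%N = k%:~R by rewrite -kE /rescale expr1 mulrC.
have {}zE : C * f 1%N = z%:~R by rewrite -zE /rescale expr1 mulrC.
have z0 : z != 0 by rewrite -(intr_eq0 rat) -zE mulf_neq0 // gt_eqF.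
have zm : `|z|%N = m.
  by apply/eqP; rewrite -(eqr_nat rat) -Cm zE -intr_norm -abszE.
pose g := gcdz k z.
have g0 : g != 0 by rewrite gcdz_eq0 negb_and z0 orbT.
have /dvdzP [k' kE'] := dvdz_gcdl k z; have /dvdzP [z' zE'] := dvdz_gcdr k z.
rewrite -/g in kE' zE'.
have cop : coprimez k' z'.
  have : gcdz (k' * g) (z' * g) = g by rewrite -kE' -zE'.
  rewrite -mulz_gcdl => /eqP; rewrite -[X in _ == X]mul1r.
  have gn : `|g|%:Z = g by rewrite gez0_abs // /g gcdz_ge0.
  by rewrite gn => /eqP /(mulIf g0) E; rewrite /coprimez E.
(* Both c and C are integral multiples of e with coprime factors k' and z', so e is admissible;
   minimality of C then leaves z' = 1 or -1. *)
pose e : rat := g%:~R / f 1%N.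
have cE : c = e * k'%:~R by rewrite /e mulrAC -intrM mulrC -[(g * k')%R]mulrC -kE' -kE mulrC mulfK.
have CE : C = e * z'%:~R by rewrite /e mulrAC -intrM mulrC -[(g * z')%R]mulrC -zE' -zE mulrC mulfK.
have Se : S e.
  move=> n; rewrite /rescale.
  apply: (@int_of_coprime_multiples _ (k' ^+ n) (z' ^+ n)).
  - by rewrite coprimezXl // coprimezXr.
  - by rewrite rmorphXn -mulrA -exprMn -cE; apply: hc.
  by rewrite rmorphXn -mulrA -exprMn -CE; apply: SC.
have en0 : e != 0 by rewrite mulf_neq0 ?invr_eq0 ?intr_eq0.
have [m' Pm' m'E] := S_norm e Se en0.
have := mmin _ Pm'.
have -> : m' = `|g|%N.
  by apply/eqP; rewrite -(eqr_nat rat) -m'E /e divfK // -intr_norm -abszE.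
move=> mg; have z'1 : (`|z'| <= 1)%N.
  have g0' : (0 < `|g|)%N by rewrite absz_gt0.
  by rewrite -(leq_pmul2r g0') mul1n -abszM -zE' zm.
have : z' = 1 \/ z' = -1.
  by move: z'1 z0; rewrite zE'; case: z' {zE' cop CE} => [[|[|//]]|[|//]] _ //=;
     rewrite ?mul0r ?eqxx //; [left|right].
move=> [z'E|z'E]; rewrite z'E in CE.
  by exists k'; rewrite cE CE mulr1.
by exists (- k'); rewrite cE CE !mulrNz; ring.
Qed.

Lemma hypergeom0 (alpha beta : seq rat) : hypergeom alpha beta 0 = 1.
Proof.
by rewrite /hypergeom !big1 ?divr1 // => x _; rewrite /poch big_ord0.
Qed.

Lemma prod_poch_neq0 (s : seq rat) (n : nat) : all admissible s ->
  \prod_(x <- s) poch x n != 0.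
Proof.
move=> hs; rewrite big_seq; elim/big_rec: _ => // x y xs y0.
by rewrite mulf_neq0 // poch_neq0 // (allP hs).
Qed.

Lemma prod_den_gt0 (s : seq rat) : 0 < \prod_(x <- s) (den x)%:R :> rat.
Proof. by elim/big_rec: _ => // x y _ y0; rewrite mulr_gt0 // ltr0n den_gt0. Qed.

Lemma den_dvd_den_lcm (alpha beta : seq rat) (x : rat) :
  x \in alpha ++ beta -> (den x %| den_lcm alpha beta)%N.
Proof.
rewrite /den_lcm; elim: (alpha ++ beta) => // y s IH.
rewrite inE big_cons => /orP[/eqP ->|/IH h]; first exact: dvdn_lcml.
exact: dvdn_trans h (dvdn_lcmr _ _).
Qed.

Section Eisenstein.
Variables (alpha beta : seq rat).
Hypotheses (ha : all admissible alpha) (hb : all admissible beta).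
Let f := hypergeom alpha beta.
Let Q : rat := (\prod_(a <- alpha) (den a)%:R) / (\prod_(b <- beta) (den b)%:R).
Let K := Q * calP_factor alpha beta.
Let lam p := lambda p alpha beta.

Let f_neq0 n : f n != 0.
Proof. by rewrite mulf_neq0 ?invr_eq0 ?prod_poch_neq0. Qed.

Let Q_gt0 : 0 < Q. Proof. by rewrite divr_gt0 ?prod_den_gt0. Qed.

Let calP_factor_gt0 : 0 < calP_factor alpha beta.
Proof.
rewrite /calP_factor; elim/big_rec: _ => // p y /andP[pp _] y0.
by rewrite mulr_gt0 // exprz_gt0 // ltr0n prime_gt0.
Qed.

Lemma K_gt0 : 0 < K. Proof. by rewrite mulr_gt0. Qed.

Let pow p : int := if calP alpha beta p then
  Num.floor ((lam p)%:~R / (p%:R - 1) : rat) else 0.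

Let val_K (p : nat) : prime p -> padic_val p K = padic_val p Q - pow p.
Proof.
move=> pp; rewrite padic_valM ?(gt_eqF Q_gt0) ?(gt_eqF calP_factor_gt0) //; congr (_ + _).
rewrite /calP_factor big_mkcond padic_val_prod; last first.
  move=> q; case: ifP => // /andP[pq _].
  by rewrite expfz_neq0 // pnatr_eq0 -lt0n prime_gt0.
rewrite /pow; have E q : q != p -> padic_val p (if calP alpha beta q then
  (q%:R : rat) ^ (- Num.floor ((lambda q alpha beta)%:~R / (q%:R - 1) : rat)) else 1) = 0.
  case: ifP => [/andP[pq _] qp|_ _]; last exact: padic_val1.
  rewrite padic_val_exprz ?pnatr_eq0 -?lt0n ?prime_gt0 // padic_val_nat ?prime_gt0 //.
  by rewrite logn_prime // eq_sym (negbTE qp) mulr0.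
case: ifP => hp; last first.
  rewrite oppr0 big1 // => q _; have [->|] := eqVneq q p; last exact: E.
  by rewrite hp padic_val1.
rewrite (bigD1_seq p) ?iota_uniq ?mem_index_iota ?ltnS ?calP_le_bound //= hp.
rewrite big1 ?addr0 => [|q qp]; last exact: E.
rewrite padic_val_exprz ?pnatr_eq0 -?lt0n ?prime_gt0 // padic_val_nat ?prime_gt0 //.
by rewrite logn_prime // eqxx mulr1.
Qed.

Let pred_p p : prime p -> (p%:R - 1 : rat) = p.-1%:R.
Proof. by move=> pp; rewrite -subn1 natrB // prime_gt0. Qed.

Lemma integral_multiple_of_K (C : rat) : 0 < C -> integral_series (rescale C f) ->
  exists N : nat, C = N%:R * K.
Proof.
move=> C0 hC; have Cn0 : C != 0 by rewrite gt_eqF.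
have Kn0 : K != 0 by rewrite gt_eqF ?K_gt0.
suff : C / K \is a Num.int.
  move=> /intrP[z zE]; have z0 : 0 <= z by rewrite -(ler0z rat) -zE divr_ge0 // ltW // K_gt0.
  exists `|z|%N; rewrite -[`|z|%N%:R]/(`|z|%N%:Z%:~R) gez0_abs // -zE divfK //.
apply/int_padic_val; first by rewrite mulf_neq0 ?invr_eq0.
move=> p pp; rewrite padic_val_div // val_K //.
set X := padic_val p C - padic_val p Q.
have p1 : (0 < p.-1)%N by rewrite -subn1 subn_gt0 prime_gt1.
have main : 0 <= p.-1%:Z * X + lam p.
  have [Ta hTa] := padic_val_prod_poch_pow pp ha.
  have [Tb hTb] := padic_val_prod_poch_pow pp hb.
  rewrite leNgt; apply/negP => neg.
  have T0 : 0 <= Ta + Tb.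
    by apply: addr_ge0; [apply: le_trans (hTa 0%N)|apply: le_trans (hTb 0%N)].
  (* If the slope were negative, hence at most -1, the valuation at n = p^L would fall below 0 as
     soon as n exceeds the accumulated error Ta + Tb. *)
  pose L := `|(Ta + Tb)%R|%N; pose n := (p ^ L)%N.
  have nT : Ta + Tb < n%:Z by rewrite -[Ta + Tb]gez0_abs // ltz_nat ltn_expl // prime_gt1.
  have /(int_padic_val _).1 : f n * C ^+ n \is a Num.int := hC n.
  rewrite mulf_neq0 ?expf_neq0 // => /(_ isT p pp).
  rewrite padic_valM ?expf_neq0 // padic_valX // /f /hypergeom.
  rewrite padic_val_div ?prod_poch_neq0 //.
  have := hTa L; have := hTb L; rewrite -/n.
  set va := padic_val p (\prod_(x <- alpha) poch x n).
  set vb := padic_val p (\prod_(x <- beta) poch x n).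
  rewrite !ler_norml => /andP[hb1 _] /andP[_ ha1] hint.
  have QE : padic_val p Q = padic_val p (\prod_(a <- alpha) (den a)%:R)
      - padic_val p (\prod_(b <- beta) (den b)%:R).
    by rewrite padic_val_div ?gt_eqF ?prod_den_gt0.
  move: hb1 ha1 neg; rewrite /X QE /lam /lambda.
  set da := padic_val p (\prod_(x <- alpha) _); set db := padic_val p (\prod_(x <- beta) _).
  set ca := (count _ alpha)%:Z; set cb := (count _ beta)%:Z => hb1 ha1 neg.
  have h2 : 0 <= p.-1%:Z * (va - vb + n%:Z * padic_val p C) by rewrite mulr_ge0.
  have n0 : 0 <= n%:Z by [].
  have h3 : (p.-1%:Z * (padic_val p C - (da - db)) + (ca - cb)) * n%:Z <= - 1 * n%:Z.
    rewrite ler_wpM2r //; move: neg; rewrite -/X; clear; move: (_ + _) => Y; lia.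
  have : p.-1%:Z * (va - vb + n%:Z * padic_val p C) <= Ta + Tb +
    (p.-1%:Z * (padic_val p C - (da - db)) + (ca - cb)) * n%:Z.
    have -> : (p.-1%:Z * (padic_val p C - (da - db)) + (ca - cb)) * n%:Z =
      (ca - p.-1%:Z * da) * n%:Z - (cb - p.-1%:Z * db) * n%:Z + p.-1%:Z * (n%:Z * padic_val p C) by ring.
    rewrite mulrDr mulrBr; move: hb1 ha1.
    move: (p.-1%:Z * va) (p.-1%:Z * vb) ((ca - _) * _) ((cb - _) * _) (p.-1%:Z * (_ * _)).
    clear => A B E1 E2 E3; lia.
  move: h2 h3 n0 nT; move: (p.-1%:Z * (va - _ + _)) (_ * n%:Z); clear => A B; lia.
have p1' : 0 < p.-1%:R :> rat by rewrite ltr0n.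
have XE : padic_val p C - (padic_val p Q - pow p) = X + pow p by rewrite /X; ring.
(* X is an integer, so - X <= lambda / (p - 1) may be rounded down. *)
have fl : - X <= Num.floor ((lam p)%:~R / (p%:R - 1) : rat).
  rewrite floor_ge_int pred_p // ler_pdivlMr // -[p.-1%:R]/(p.-1%:Z%:~R) -intrM ler_int; lia.
rewrite XE /pow; case: ifP => hP; first by lia.
rewrite addr0.
(* Outside [calP] no correction is available: (p - 1) X >= - lambda > - (p - 1) gives X > -1, so X
   >= 0. *)
suff : lam p < p.-1%:Z by nia.
move: hP; rewrite /calP pp /= => /negbT; rewrite negb_or => /andP[pd pr].
have allZ x : x \in alpha ++ beta -> in_Zp p x.
  move=> hx; rewrite in_ZpE //; apply: contra pd => px.
  exact: dvdn_trans px (den_dvd_den_lcm hx).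
have cnt_all s : {subset s <= alpha ++ beta} -> count (in_Zp p) s = size s.
  by move=> hs; apply/eqP; rewrite -all_count; apply/allP => x /hs /allZ.
rewrite /lam /lambda (cnt_all alpha) => [|x hx]; last by rewrite mem_cat hx.
rewrite (cnt_all beta) => [|x hx]; last by rewrite mem_cat hx orbT.
have := prime_gt0 pp; move: pr; rewrite -ltNge; clear.
by case: p => // q; rewrite /= intS addrC ltrD2l.
Qed.

Hypothesis sz : size alpha = size beta.
Hypotheses (ra : {in alpha, forall x, 0 < x <= 1}) (rb : {in beta, forall x, 0 < x <= 1}).
Hypothesis hN : N_integral f.

(** [key_inequality] over a common denominator: each parameter outside Z_p has weight n, and since
    the tuples have equal size, beta has lambda more of these than alpha. *)
Let val_lower (p n : nat) : prime p ->
  n%:Z * lam p <= p.-1%:Z * (padic_val p (f n) + n%:Z * padic_val p Q).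
Proof.
move=> pp; pose D := den_lcm alpha beta.
have D0 : (0 < D)%N := den_lcm_gt0 alpha beta.
have [d' cop DE] := pfactor_coprime pp D0.
(* The extra factor p makes e positive and d > 1 even if p does not divide D; the fractions over d
   need not be reduced. *)
pose e := (logn p D).+1; pose d := (p ^ e * d')%N.
have dE : d = (p * D)%N by rewrite /d /e expnS -mulnA [X in _ = (p * X)%N]DE [(d' * _)%N]mulnC.
have d0 : (0 < d)%N by rewrite dE muln_gt0 prime_gt0.
have d'0 : (0 < d')%N by move: d0; rewrite muln_gt0 => /andP[].
have pd' : ~~ (p %| d')%N by rewrite -prime_coprime.
pose num (x : rat) : nat := (`|numq x| * (d %/ den x))%N.
have numE x : x \in alpha ++ beta -> 0 < x <= 1 -> x = (num x)%:Z%:~R / d%:R /\ (0 < num x <= d)%N.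
  move=> hx /andP[x0 x1].
  have dvd : (den x %| d)%N by rewrite dE dvdn_mull // den_dvd_den_lcm.
  have E : x = (num x)%:Z%:~R / d%:R.
    rewrite {1}(rat_num_den x) /num -[(_ * _)%N%:Z%:~R]/((_ * _)%N%:R) natrM -{2}(divnK dvd) natrM.
    have d1 : ((den x)%:R : rat) != 0 by rewrite pnatr_eq0 -lt0n den_gt0.
    have d2 : ((d %/ den x)%:R : rat) != 0.
      by rewrite pnatr_eq0 -lt0n divn_gt0 ?den_gt0 // dvdn_leq.
    have -> : (numq x)%:~R = `|numq x|%N%:R :> rat.
      by rewrite -[_%:R in RHS]/(_%:Z%:~R) gez0_abs // ltW // numq_gt0.
    by move: d1 d2; set y := (den x)%:R; set z := (d %/ _)%:R => d1 d2; field; rewrite d1.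
  split=> //; have d0' : 0 < d%:R :> rat by rewrite ltr0n.
  rewrite E in x0 x1; move: x0 x1; rewrite pmulr_lgt0 ?invr_gt0 // ler_pdivrMr // mul1r.
  by rewrite -[(num x)%:Z%:~R]/((num x)%:R) ltr0n ler_nat => -> ->.
have inA x : x \in alpha -> x \in alpha ++ beta by rewrite mem_cat => ->.
have inB x : x \in beta -> x \in alpha ++ beta by rewrite mem_cat orbC => ->.
have numA x (hx : x \in alpha) := numE x (inA x hx) (ra hx).
have numB x (hx : x \in beta) := numE x (inB x hx) (rb hx).
have val_prod q s : all admissible s -> {in s, forall x, x = (num x)%:Z%:~R / d%:R} ->
  forall m, padic_val q (\prod_(x <- s) poch x m)
   = (\sum_(u <- map num s) lognprod q d u m)%N%:Z - (size s)%:Z * (m%:Z * (logn q d)%:Z).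
  elim: s => [|x s IH] /= hs hnum m; first by rewrite !big_nil padic_val1 mul0r.
  have /andP[hx hs'] := hs.
  rewrite !big_cons padic_valM ?poch_neq0 ?prod_poch_neq0 // IH //; last first.
    by move=> y ys; apply: hnum; rewrite inE ys orbT.
  by rewrite (padic_val_poch q m (hnum x (mem_head _ _))) // PoszD intS; ring.
pose weight u := if (p ^ e %| u)%N then (p.-1 * lognprod p d' (u %/ p ^ e)%N n)%N else n.
have key : (\sum_(v <- map num beta) weight v <= \sum_(u <- map num alpha) weight u)%N.
  apply: (@key_inequality p e d' pp isT d'0 cop); rewrite ?size_map //.
  - by move=> u /mapP[x hx ->]; have [] := numA x hx.
  - by move=> u /mapP[x hx ->]; have [] := numB x hx.
  have [c cn0 hc] := hN.
  (* A larger prime q divides neither d nor the numerator or denominator of c, so integrality at q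
     compares the two Pochhammer products directly. *)
  exists (d + `|numq c| + den c)%N => q m pq Bq.
  have vc : padic_val q c = 0.
    rewrite /padic_val !ndvd_logn0 ?subrr //; apply/negP => /dvdn_leq h.
      by have := h (den_gt0 c); lia.
    by have := h; rewrite absz_gt0 numq_eq0 cn0 => /(_ isT); lia.
  have qd : logn q d = 0%N.
    by apply: ndvd_logn0; apply/negP => /dvdn_leq => /(_ d0); rewrite -/d; lia.
  have /(int_padic_val _).1 : f m * c ^+ m \is a Num.int := hc m.
  rewrite mulf_neq0 ?expf_neq0 // => /(_ isT q pq).
  rewrite padic_valM ?expf_neq0 // padic_valX // vc mulr0 addr0 /f /hypergeom.
  rewrite padic_val_div ?prod_poch_neq0 // !val_prod // => [|x /numB[]|x /numA[]] //.
  by rewrite qd !mulr0 !subr0 subr_ge0 lez_nat.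
have wE x : admissible x -> x = (num x)%:Z%:~R / d%:R -> (0 < num x)%N ->
  (weight (num x))%:Z = p.-1%:Z * (padic_val p (poch x n) + n%:Z * (logn p (den x))%:Z)
     + n%:Z - (in_Zp p x)%:Z * n%:Z.
  move=> hx xE u0; rewrite /weight.
  have ld : logn p d = e.
    have pe0 : (0 < p ^ e)%N by rewrite expn_gt0 prime_gt0.
    by rewrite /d (lognM _ pe0 d'0) pfactorK // (ndvd_logn0 pd') addn0.
  have ZE : in_Zp p x = (p ^ e %| num x)%N.
    rewrite /in_Zp [in LHS]xE -[d%:R]/(d%:Z%:~R) padic_valE ?eqz_nat -?lt0n // !absz_nat ld.
    by rewrite subr_ge0 lez_nat pfactor_dvdn.
  rewrite -ZE; case hZ: (in_Zp p x).
    have pden : logn p (den x) = 0%N by apply: ndvd_logn0; rewrite -in_ZpE.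
    rewrite pden mulr0 addr0 mul1r addrK.
    rewrite ZE in hZ; have /dvdnP[u1 uE] := hZ.
    have xE' : x = u1%:Z%:~R / d'%:R.
      rewrite xE uE /d -[(u1 * _)%N%:Z%:~R]/((u1 * p ^ e)%N%:R) !natrM -[u1%:Z%:~R]/(u1%:R).
      have h1 : ((p ^ e)%N%:R : rat) != 0 by rewrite pnatr_eq0 -lt0n expn_gt0 prime_gt0.
      have h2 : (d'%:R : rat) != 0 by rewrite pnatr_eq0 -lt0n.
      by rewrite [X in _ / X]mulrC -mulf_div divff // mulr1.
    rewrite (padic_val_poch p n xE') // (ndvd_logn0 pd') mulr0 subr0.
    by rewrite uE mulnK ?expn_gt0 ?prime_gt0 // PoszM.
  by rewrite (padic_val_poch_notin _ pp) ?hZ // addNr mulr0 add0r mul0r subr0.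
have sumE s : all admissible s -> {in s, forall x, x = (num x)%:Z%:~R / d%:R /\ (0 < num x <= d)%N} ->
  (\sum_(u <- map num s) weight u)%N%:Z
  = p.-1%:Z * (padic_val p (\prod_(x <- s) poch x n)
       + n%:Z * padic_val p (\prod_(x <- s) (den x)%:R))
    + n%:Z * ((size s)%:Z - (count (in_Zp p) s)%:Z).
  elim: s => [|x s IH] /= hs hnum; first by rewrite !big_nil padic_val1; ring.
  have /andP[hx hs'] := hs; have [xE /andP[u0 _]] := hnum x (mem_head _ _).
  rewrite !big_cons padic_valM ?poch_neq0 ?prod_poch_neq0 //.
  rewrite padic_valM ?gt_eqF ?prod_den_gt0 ?ltr0n ?den_gt0 // padic_val_nat ?den_gt0 //.
  rewrite PoszD IH //; last by move=> y ys; apply: hnum; rewrite inE ys orbT.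
  by rewrite (wE x hx xE u0) intS PoszD; ring.
move: key; rewrite -lez_nat !sumE // sz.
rewrite /f /hypergeom /lam /lambda padic_val_div ?prod_poch_neq0 //.
rewrite padic_val_div ?gt_eqF ?prod_den_gt0 // => h; rewrite -subr_ge0 in h; rewrite -subr_ge0.
by apply: le_trans h _; rewrite le_eqVlt; apply/orP; left; apply/eqP; ring.
Qed.

Lemma integral_K : integral_series (rescale K f).
Proof.
have Kn0 : K != 0 by rewrite gt_eqF ?K_gt0.
move=> n; apply/int_padic_val; first by rewrite mulf_neq0 ?expf_neq0.
move=> p pp; rewrite padic_valM ?expf_neq0 // padic_valX // val_K //.
have p1 : (0 < p.-1)%N by rewrite -subn1 subn_gt0 prime_gt1.
have h := val_lower n pp.
rewrite -(@pmulr_rge0 _ p.-1%:Z) ?ltz_nat //.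
suff : n%:Z * (p.-1%:Z * pow p) <= n%:Z * lam p.
  move=> h2; have -> : p.-1%:Z * (padic_val p (f n) + n%:Z * (padic_val p Q - pow p))
    = p.-1%:Z * (padic_val p (f n) + n%:Z * padic_val p Q) - n%:Z * (p.-1%:Z * pow p) by ring.
  by rewrite subr_ge0 (le_trans h2).
rewrite ler_wpM2l // /pow; case: ifP => hP.
  have p1' : 0 < p.-1%:R :> rat by rewrite ltr0n.
  have := floor_le ((lam p)%:~R / (p%:R - 1) : rat).
  rewrite {2}pred_p // ler_pdivlMr // -[p.-1%:R]/(p.-1%:Z%:~R) -intrM ler_int mulrC.
  by [].
rewrite mulr0; move: hP; rewrite /calP pp /= => /negbT; rewrite negb_or => /andP[pd _].
have cnt_all s : {subset s <= alpha ++ beta} -> count (in_Zp p) s = size s.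
  move=> hs; apply/eqP; rewrite -all_count; apply/allP => x /hs hx.
  by rewrite in_ZpE //; apply: contra pd => px; apply: dvdn_trans px (den_dvd_den_lcm hx).
rewrite /lam /lambda (cnt_all alpha) => [|x hx]; last by rewrite mem_cat hx.
rewrite (cnt_all beta) => [|x hx]; last by rewrite mem_cat hx orbT.
by rewrite sz subrr.
Qed.
End Eisenstein.

Theorem theorem1 (r s : nat) (alpha : r.-tuple rat) (beta : s.-tuple rat)
    (halpha : forall i : 'I_r, admissible (tnth alpha i))
    (hbeta : forall j : 'I_s, admissible (tnth beta j))
    (hN : N_integral (hypergeom alpha beta)) :
  exists Cab : rat,
    is_eisenstein_constant alpha beta Cab /\
    exists C : nat,
      Cab = C%:R
            * ((\prod_(i < r) (den (tnth alpha i))%:R)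
               / (\prod_(j < s) (den (tnth beta j))%:R))
            * calP_factor alpha beta
      /\ (r = s ->
          (forall i : 'I_r, 0 < tnth alpha i <= 1) ->
          (forall j : 'I_s, 0 < tnth beta j <= 1) ->
          C = 1%N).
Proof.
have ha : all admissible alpha by apply/all_tnthP.
have hb : all admissible beta by apply/all_tnthP.
have f1 : hypergeom alpha beta 1 != 0 by rewrite mulf_neq0 ?invr_eq0 ?prod_poch_neq0.
have [C C0 hC] := eisenstein_generator (hypergeom0 alpha beta) f1 hN.
have SC : integral_series (rescale C (hypergeom alpha beta)).
  by apply/hC; exists 1; rewrite mulr1.
have [N NE] := integral_multiple_of_K ha hb C0 SC.
exists C; split=> //; exists N; split.
  by rewrite NE !big_tuple mulrA.
move=> rs halpha1 hbeta1.
have K0 := K_gt0 alpha beta.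
have sz : size alpha = size beta by rewrite !size_tuple.
have ra : {in alpha, forall x, 0 < x <= 1} by move=> x /tnthP[i ->].
have rb : {in beta, forall x, 0 < x <= 1} by move=> x /tnthP[i ->].
have SK := integral_K ha hb sz ra rb hN.
have [k kE] := (hC _).1 SK.
(* K = C k = N k K with K > 0, so N k = 1 and the natural number N is 1. *)
move: kE; rewrite {1}NE => kE.
have E : (N%:Z * k)%:~R = 1 :> rat.
  apply: (mulIf (lt0r_neq0 K0)); rewrite mul1r {2}kE intrM; ring.
have : N%:Z * k = 1 by apply: (@intr_inj rat).
by move=> /(congr1 absz); rewrite abszM absz_nat => /eqP; rewrite muln_eq1 => /andP[/eqP].
Qed.
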